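(* Let $R$ be a unital associative superalgebra over $\Bbbk$ and $n\geqslant 3$. Then the second homology (with trivial coefficients $\Bbbk$) of the special queer Lie superalgebra satisfies $\mathrm{H}_2(\mathfrak{sq}_n(R))\cong\mathrm{HC}_1(R)\otimes\Bbbk^{0|1}$.
   Context: $\Bbbk$ is a unital commutative associative ring in which $2$ is invertible; $|x|$ denotes parity. $\mathfrak{gl}_{n|n}(R)$ is the Lie superalgebra of $2n\times 2n$ matrices over $R$ with matrix unit $e_{ij}(a)$ of parity $|i|+|j|+|a|$ ($|i|=0$ for $i\leqslant n$, $|i|=1$ for $i>n$) and bracket $[X,Y]=XY-(-1)^{|X||Y|}YX$. For homogeneous $a\in R$, $\rho(a)=(-1)^{|a|}a$ (extended linearly), applied entrywise to matrices. $\mathfrak{q}_n(R)=\left\{\begin{pmatrix}A&B\\\rho(B)&\rho(A)\end{pmatrix}: A,B\in \mathrm{M}_n(R)\right\}\subseteq\mathfrak{gl}_{n|n}(R)$ and $\mathfrak{sq}_n(R)=[\mathfrak{q}_n(R),\mathfrak{q}_n(R)]$. Let $I_R\subseteq R\otimes R$ be the $\Bbbk$-submodule generated by $a\otimes b+(-1)^{|a||b|}b\otimes a$ and $(-1)^{|a||c|}ab\otimes c+(-1)^{|b||a|}bc\otimes a+(-1)^{|c||b|}ca\otimes b$ for homogeneous $a,b,c\in R$, $\langle R,R\rangle=(R\otimes R)/I_R$ with $\boldsymbol{\lambda}(a,b)$ the image of $a\otimes b$, and $\mathrm{HC}_1(R)=\{\sum_i\boldsymbol{\lambda}(a_i,b_i):\sum_i(a_ib_i-(-1)^{|a_i||b_i|}b_ia_i)=0\}$.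 $\Bbbk^{0|1}$ is the graded module with zero even part and odd part $\Bbbk$, so $M\otimes\Bbbk^{0|1}$ is $M$ with parity reversed. *)

(* Defs.v *)
From HB Require Import structures.
From mathcomp Require Import all_boot all_order all_algebra.
From mathcomp Require Import finmap.
From mathcomp.multinomials Require Import monalg.
From Stdlib Require List.

Set Implicit Arguments.
Unset Strict Implicit.
Unset Printing Implicit Defensive.

Import Order.TTheory GRing.Theory.
Local Open Scope ring_scope.

Section Defs.

Variable k : comNzRingType.

Definition kspan (V : lmodType k) (P : V -> Prop) (v : V) : Prop :=
  exists l : seq (k * V),
    (forall t, List.In t l -> P t.2) /\ v = \sum_(t <- l) t.1 *: t.2.

Definition sgn (b : bool) : k := if b then -1 else 1.

(* Superalgebras.  A Z/2-grading of the k-algebra R is given by the   *)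
(* two homogeneous components Rp false (even) and Rp true (odd).      *)
Variable R : algType k.

Record supergrading (Rp : bool -> R -> Prop) : Prop := SuperGrading {
  sg_0 : forall p, Rp p 0;
  sg_add : forall p a b, Rp p a -> Rp p b -> Rp p (a + b);
  sg_scale : forall p (c : k) a, Rp p a -> Rp p (c *: a);
  sg_decomp : forall a, exists a0 a1, [/\ Rp false a0, Rp true a1 & a = a0 + a1];
  sg_direct : forall a, Rp false a -> Rp true a -> a = 0;
  sg_1 : Rp false 1;
  sg_mul : forall p q a b, Rp p a -> Rp q b -> Rp (p (+) q) (a * b)
}.

Variable Rp : bool -> R -> Prop.

Definition rho_rel (c b : R) : Prop :=
  exists b0 b1, [/\ Rp false b0, Rp true b1, b = b0 + b1 & c = b0 - b1].

Variable n : nat.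
Local Notation M := 'M[R]_(n + n).

Definition ipar (i : 'I_(n + n)) : bool := (n <= i)%N.

Definition mx_homog (p : bool) (X : M) : Prop :=
  forall i j, Rp (p (+) ipar i (+) ipar j) (X i j).

Definition kscale (c : k) (X : M) : M := map_mx (fun a => c *: a) X.

(* super bracket of homogeneous X (parity p), Y (parity q) *)
Definition sbr (p q : bool) (X Y : M) : M :=
  if p && q then X *m Y + Y *m X else X *m Y - Y *m X.

Definition in_q (X : M) : Prop :=
  forall i j : 'I_n,
    rho_rel (X (rshift n i) (rshift n j)) (X (lshift n i) (lshift n j)) /\
    rho_rel (X (rshift n i) (lshift n j)) (X (lshift n i) (rshift n j)).

Definition mx_kspan (P : M -> Prop) (X : M) : Prop :=
  exists l : seq (k * M),
    (forall t, List.In t l -> P t.2) /\ X = \sum_(t <- l) kscale t.1 t.2.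

Definition in_sq (X : M) : Prop :=
  mx_kspan (fun Y => exists p q X1 X2,
     [/\ in_q X1, in_q X2, mx_homog p X1, mx_homog q X2 & Y = sbr p q X1 X2]) X.

Definition sq_homog (p : bool) (X : M) : Prop := in_sq X /\ mx_homog p X.

End Defs.

(* Tensor squares as quotients of free k-modules on pairs of          *)
(* homogeneous elements.                                              *)
Section Tensor.
Variable k : comNzRingType.
Variable T : choiceType.
Variable add : T -> T -> T.
Variable sc : k -> T -> T.
Variable h : bool -> T -> Prop.  (* homogeneous elements of a given parity *)

Local Notation K2 := ((bool * T) * (bool * T))%type.
Local Notation F2 := {malg k[K2]}.

Definition e2 (p : bool) (x : T) (q : bool) (y : T) : F2 := << ((p, x), (q, y)) >>.

Definition valid2 (v : F2) : Prop :=
  forall t, t \in msupp v -> h t.1.1 t.1.2 /\ h t.2.1 t.2.2.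

Definition homog2 (s : bool) (v : F2) : Prop :=
  forall t, t \in msupp v -> t.1.1 (+) t.2.1 = s.

(* bilinearity relations (generators of the kernel F2 -> V (x) V) *)
Definition bilin_rel (v : F2) : Prop :=
  (exists p q x x' y, [/\ h p x, h p x', h q y &
       v = e2 p (add x x') q y - e2 p x q y - e2 p x' q y]) \/
  (exists p q x y y', [/\ h p x, h q y, h q y' &
       v = e2 p x q (add y y') - e2 p x q y - e2 p x q y']) \/
  (exists (c : k) p q x y, [/\ h p x, h q y &
       v = e2 p (sc c x) q y - c *: e2 p x q y]) \/
  (exists (c : k) p q x y, [/\ h p x, h q y &
       v = e2 p x q (sc c y) - c *: e2 p x q y]).

Definition santisym_rel (v : F2) : Prop :=
  exists p q x y, [/\ h p x, h q y &
       v = e2 p x q y + sgn k (p && q) *: e2 q y p x].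

End Tensor.

(* The Chevalley-Eilenberg data for H_2(sq_n(R)) lifted to the free    *)
(* module on pairs of homogeneous elements of sq_n(R).                 *)
Section H2.
Variable k : comNzRingType.
Variable R : algType k.
Variable Rp : bool -> R -> Prop.
Variable n : nat.
Local Notation M := 'M[R]_(n + n).
Local Notation gh := (sq_homog Rp (n := n)).
Local Notation F2 := {malg k[((bool * M) * (bool * M))%type]}.
Local Notation e2 := (@e2 k M).

Definition d2 (v : F2) : M :=
  \sum_(t <- msupp v) kscale (v@_t) (sbr t.1.1 t.2.1 t.1.2 t.2.2).

Definition d3_gen (v : F2) : Prop :=
  exists p q r X Y Z, [/\ gh p X, gh q Y, gh r Z &
    v = e2 (p (+) q) (sbr p q X Y) r Z
        - sgn k (q && r) *: e2 (p (+) r) (sbr p r X Z) q Y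
        + sgn k (p && (q (+) r)) *: e2 (q (+) r) (sbr q r Y Z) p X].

Definition Z2 (v : F2) : Prop := valid2 gh v /\ d2 v = 0.

(* boundaries: preimage of im d_3 (together with the relations
   defining the super exterior square) *)
Definition B2 : F2 -> Prop :=
  kspan (fun v => bilin_rel +%R (@kscale k R n) gh v \/
                  santisym_rel gh v \/ d3_gen v).

End H2.

(* <R,R> and HC_1(R) lifted to the free module on pairs of homogeneous *)
(* elements of R.                                                       *)
Section HC1.
Variable k : comNzRingType.
Variable R : algType k.
Variable Rp : bool -> R -> Prop.
Local Notation F2 := {malg k[((bool * R) * (bool * R))%type]}.
Local Notation e2 := (@e2 k R).

Definition cyc_rel (v : F2) : Prop :=
  exists p q r a b c, [/\ Rp p a, Rp q b, Rp r c &
    v = sgn k (p && r) *: e2 (p (+) q) (a * b) r c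
        + sgn k (q && p) *: e2 (q (+) r) (b * c) p a
        + sgn k (r && q) *: e2 (r (+) p) (c * a) q b].

(* generators of I_R (plus the relations defining R (x) R) *)
Definition BHC (v : F2) : Prop :=
  kspan (fun w => bilin_rel +%R ( *:%R ) Rp w \/
                  santisym_rel Rp w \/ cyc_rel w) v.

Definition scomm (p q : bool) (a b : R) : R :=
  if p && q then a * b + b * a else a * b - b * a.

Definition ZHC (v : F2) : Prop :=
  valid2 Rp v /\
  \sum_(t <- msupp v) v@_t *: scomm t.1.1 t.2.1 t.1.2 t.2.2 = 0.

End HC1.

(* Graded isomorphism of k-modules  Z1/(Z1 /\ B1) ~ (Z2 + B2)/B2,      *)
(* shifting parity by [shift], given by a function on representatives. *)
Definition graded_quot_iso (k : comNzRingType) (V W : lmodType k)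
    (Z1 B1 : V -> Prop) (hV : bool -> V -> Prop)
    (Z2 B2 : W -> Prop) (hW : bool -> W -> Prop) (shift : bool) : Prop :=
  exists f : V -> W,
    (forall z, Z1 z -> Z2 (f z)) /\
    [/\
        (forall z z', Z1 z -> Z1 z' -> B1 (z - z') -> B2 (f z - f z')),
        (forall (c : k) z z', Z1 z -> Z1 z' ->
             B2 (f (c *: z + z') - (c *: f z + f z'))),
        (forall z, Z1 z -> B2 (f z) -> B1 z),
        (forall w, Z2 w -> exists z, Z1 z /\ B2 (f z - w)) &
        (forall s z, Z1 z -> hV s z -> exists w, hW (s (+) shift) w /\ B2 (f z - w))].

(* Main.v *)
(* Let S = R[nu] with nu odd, nu^2 = 1 and nu a = rho(a) nu.  Reading off the upper
   blocks identifies q_n(R) with gl_n(S), and e_ij(a nu^b) is the matrix [emx i j b a].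
   The isomorphism is induced by the trace form
     X, Y |-> sum_ij lambda(X_ij, Y_ji),
   where lambda(a, b nu) = lambda(a, b), lambda(a nu, b) = (-1)^|b| lambda(a, b) and the
   other two combinations vanish.

   For injectivity, let beta be the universal 2-cocycle of sq_n(R), with values in
   the quotient of the exterior square by the boundaries.  On opposite root vectors
   the cocycle identity gives
     F_ij(st, u) = F_il(s, tu) + (-1)^(|s|(|t|+|u|)) F_lj(t, us)
   for F_ij(s, t) = beta(e_ij(s), e_ji(t)), and a third index forces
     F_ij(s, t) = th_i(st) - (-1)^(|s||t|) th_j(ts) + G(s, t)
   with G satisfying the relations of <S, S>.  There G(nu, c) = 0 for c in R, the part
   of G even in nu depends only on the supercommutator and the odd part is a
   function Gamma on <R, R>.  Hence beta differs from Gamma applied to the trace form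
   by a coboundary on these pairs.  Since 2 e_ii(1) = [e_ii(nu), e_ii(nu)], the
   idempotents e_ii(1) lie in sq_n(R), and their weights, which are 1 or 2, make the
   difference vanish on all other pairs of root vectors, which generate sq_n(R).
   A cycle with trivial trace form is thus killed by beta, that is, a boundary. *)

Require Import Defs.
From HB Require Import structures.
From mathcomp Require Import all_boot all_order all_algebra.
From mathcomp Require Import finmap.
From mathcomp.multinomials Require Import monalg.
From Stdlib Require Import ClassicalEpsilon FunctionalExtensionality.
From Stdlib Require Import PropExtensionality.

Set Implicit Arguments.
Unset Strict Implicit.
Unset Printing Implicit Defensive.

Import GRing.Theory.
Local Open Scope ring_scope.

(** * Linear identities in abelian groups *)

(** Reified additive expressions. Two of them agree in every abelian group as soon as their integer
    coefficients at each atom agree, which [zmod] decides by computation. *)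
Inductive zexp :=
  | ZVar of nat | ZZero | ZAdd of zexp & zexp | ZOpp of zexp.

Fixpoint zeval (W : zmodType) (env : seq W) (e : zexp) : W :=
  match e with
  | ZVar i => env`_i
  | ZZero => 0
  | ZAdd e1 e2 => zeval env e1 + zeval env e2
  | ZOpp e1 => - zeval env e1
  end.

Fixpoint zcoef (e : zexp) (i : nat) : int :=
  match e with
  | ZVar j => if i == j then 1 else 0
  | ZZero => 0
  | ZAdd e1 e2 => zcoef e1 i + zcoef e2 i
  | ZOpp e1 => - zcoef e1 i
  end.

Lemma zevalE (W : zmodType) (env : seq W) e :
  zeval env e = \sum_(i < size env) env`_i *~ zcoef e i.
Proof.
elim: e => [j||e1 IH1 e2 IH2|e1 IH] /=.
- case: (ltnP j (size env)) => lej; last first.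
    rewrite nth_default // big1 // => i _.
    by rewrite ltn_eqF ?mulr0z // (leq_trans (ltn_ord i) lej).
  rewrite (bigD1 (Ordinal lej)) //= eqxx big1 ?addr0 ?mulr1z // => i.
  by rewrite -val_eqE /= => /negPf->; rewrite mulr0z.
- by rewrite big1 // => i _; rewrite mulr0z.
- by rewrite IH1 IH2 -big_split; apply: eq_bigr => i _; rewrite mulrzDr.
- by rewrite IH -sumrN; apply: eq_bigr => i _; rewrite mulrNz.
Qed.

Lemma zeval_eq (W : zmodType) (env : seq W) e1 e2 :
  all (fun i => zcoef e1 i == zcoef e2 i) (iota 0 (size env)) ->
  zeval env e1 = zeval env e2.
Proof.
move/allP=> H; rewrite !zevalE; apply: eq_bigr => i _; congr (_ *~ _).
by apply/eqP/H; rewrite mem_iota /=.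
Qed.

(* Occurrences of a product, a scaling or a linear map can differ by the inferred
   paths to the algebraic structures, hence the comparison of their arguments. *)
Ltac zsame x y :=
  lazymatch x with
  | y => constr:(true)
  | @GRing.scale _ _ ?c ?v =>
    lazymatch y with
    | @GRing.scale _ _ ?d ?w => zsame2 c d v w
    | _ => constr:(false)
    end
  | @GRing.Linear.sort _ _ _ _ ?c ?v =>
    lazymatch y with
    | @GRing.Linear.sort _ _ _ _ ?d ?w => zsame2 c d v w
    | _ => constr:(false)
    end
  | @mulmx _ _ _ _ ?c ?v =>
    lazymatch y with
    | @mulmx _ _ _ _ ?d ?w => zsame2 c d v w
    | _ => constr:(false)
    end
  | @GRing.mul _ ?c ?v =>
    lazymatch y with
    | @GRing.mul _ ?d ?w => zsame2 c d v w
    | _ => constr:(false)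
    end
  | _ => constr:(false)
  end
with zsame2 c d v w :=
  let e := zsame c d in
  lazymatch e with true => zsame v w | false => constr:(false) end.
Ltac zmem x l :=
  lazymatch l with
  | nil => constr:(false)
  | ?y :: ?l' =>
    let e := zsame x y in
    lazymatch e with true => constr:(true) | false => zmem x l' end
  end.
Ltac zatoms l t :=
  lazymatch t with
  | ?a + ?b => let l1 := zatoms l a in zatoms l1 b
  | - ?a => zatoms l a
  | 0 => l
  | _ => let b := zmem t l in
    lazymatch b with true => l | false => constr:(t :: l) end
  end.
Ltac zreify l t :=
  lazymatch t with
  | ?a + ?b => let ea := zreify l a in let eb := zreify l b in
      constr:(ZAdd ea eb)
  | - ?a => let ea := zreify l a in constr:(ZOpp ea)
  | 0 => constr:(ZZero)
  | _ => zvar l t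
  end
with zvar l t :=
  lazymatch l with
  | ?y :: ?l' =>
    let e := zsame t y in
    lazymatch e with
    | true => constr:(ZVar 0)
    | false =>
      let v := zvar l' t in
      lazymatch v with ZVar ?i => constr:(ZVar (S i)) end
    end
  end.
Ltac zmod :=
  lazy beta;
  lazymatch goal with
  | |- @eq ?T ?a ?b =>
    let l := zatoms (@nil T) a in
    let l := zatoms l b in
    let ea := zreify l a in
    let eb := zreify l b in
    refine (@zeval_eq _ l ea eb _); vm_compute; reflexivity
  end.

(** In use, A = B is a signed sum of known equations and the second premise is an identity left to
    [zmod]. *)
Lemma eq_lincomb (W : zmodType) (A B x y : W) : A = B -> x - y = A - B -> x = y.
Proof. by move=> -> /eqP; rewrite subrr subr_eq0 => /eqP. Qed.

Lemma eqD2 (W : zmodType) (A B C D : W) : A = B -> C = D -> A + C = B + D.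
Proof. by move=> -> ->. Qed.

Lemma eqN2 (W : zmodType) (A B : W) : A = B -> - A = - B.
Proof. by move=> ->. Qed.

(** The sign with which an equation enters a combination depends on the parities at hand; both signs
    are tried. *)
Ltac zsigns H f := first [f H | f constr:(eqN2 H)].

(** Koszul signs act through the opposite instead of a scalar, so that a case analysis on parities
    leaves goals within reach of [zmod]. *)
Definition sg (W : zmodType) (b : bool) (x : W) : W := if b then - x else x.

Lemma sg0 (W : zmodType) b : sg b (0 : W) = 0.
Proof. by case: b; rewrite /sg ?oppr0. Qed.

Lemma sgnZ (k : comNzRingType) (W : lmodType k) b (x : W) : sgn k b *: x = sg b x.
Proof. by case: b; rewrite /sgn /sg ?scaleN1r ?scale1r. Qed.

Lemma lin_comb3 (k : comNzRingType) (V W : lmodType k) (phi : {linear V -> W})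
    c d x y z :
  phi (x - c *: y + d *: z) = phi x - c *: phi y + d *: phi z.
Proof. by rewrite linearD linearB !linearZ. Qed.

(** * Quotients and linear extensions *)

Section Quotient.
Variables (k : comNzRingType) (V : lmodType k) (P : V -> Prop).

Lemma kspan0 : kspan P 0.
Proof. by exists [::]; split => //; rewrite big_nil. Qed.

Lemma kspan_gen v : P v -> kspan P v.
Proof.
move=> Pv; exists [:: (1, v)]; split; last by rewrite big_seq1 scale1r.
by move=> t [<-|[]].
Qed.

Lemma kspanD u v : kspan P u -> kspan P v -> kspan P (u + v).
Proof.
move=> [l [Hl ->]] [m [Hm ->]]; exists (l ++ m); split; last by rewrite big_cat.
by move=> t Ht; case: (List.in_app_or _ _ _ Ht) => [/Hl|/Hm].
Qed.

Lemma kspanZ c v : kspan P v -> kspan P (c *: v).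
Proof.
move=> [l [Hl ->]]; exists [seq (c * t.1, t.2) | t <- l]; split.
  by move=> t Ht; have [t' [<- /Hl]] := proj1 (List.in_map_iff _ _ _) Ht.
by rewrite big_map scaler_sumr; apply: eq_bigr => t _; rewrite scalerA.
Qed.

Lemma kspanN v : kspan P v -> kspan P (- v).
Proof. by move=> Hv; rewrite -scaleN1r; apply: kspanZ. Qed.

Lemma kspan_lin_eq0 (W : lmodType k) (phi : {linear V -> W}) :
  (forall v, P v -> phi v = 0) -> forall v, kspan P v -> phi v = 0.
Proof.
move=> H v [l [Hl ->]]; rewrite linear_sum /=; elim: l Hl => [|t l IH] Hl.
  by rewrite big_nil.
rewrite big_cons linearZ /= H ?scaler0 ?add0r; last by apply: Hl; left.
by apply: IH => u Hu; apply: Hl; right.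
Qed.

(** Extensionality makes the predicate passed to [epsilon] depend only on the class of x, hence also
    the chosen representative. The quotient can then be the type of fixed points of this choice. *)
Definition quot_repr (x : V) : V :=
  epsilon (inhabits 0) (fun y => kspan P (x - y)).

Lemma quot_reprP x : kspan P (x - quot_repr x).
Proof.
apply: (epsilon_spec (inhabits 0) (fun y => kspan P (x - y))).
by exists x; rewrite subrr; exact: kspan0.
Qed.

Lemma quot_repr_eq x y : kspan P (x - y) -> quot_repr x = quot_repr y.
Proof.
move=> Hxy; congr epsilon; apply: functional_extensionality => z.
apply: propositional_extensionality; split => H.
  by rewrite (_ : y - z = - (x - y) + (x - z)); [apply: kspanD (kspanN _) _|zmod].
by rewrite (_ : x - z = (x - y) + (y - z)); [apply: kspanD|zmod].
Qed.

Lemma quot_repr_id x : quot_repr (quot_repr x) = quot_repr x.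
Proof.
apply: quot_repr_eq; rewrite (_ : _ - x = - (x - quot_repr x)); last by zmod.
exact: kspanN (quot_reprP x).
Qed.

Definition quot := {x : V | quot_repr x == x}.
HB.instance Definition _ := SubChoice.copy quot {x : V | quot_repr x == x}.

Definition quot_proj (x : V) : quot :=
  exist _ (quot_repr x) (introT eqP (quot_repr_id x)).

Lemma quot_projP x y : quot_proj x = quot_proj y <-> kspan P (x - y).
Proof.
split=> [/(congr1 val) /= H|/quot_repr_eq H]; last exact: val_inj.
rewrite (_ : x - y = (x - quot_repr x) + - (y - quot_repr y)).
  by apply: kspanD (kspanN _); exact: quot_reprP.
by rewrite H; zmod.
Qed.

Lemma quot_valK (x : quot) : quot_proj (val x) = x.
Proof. by apply: val_inj; apply/eqP; exact: valP x. Qed.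

Lemma quot_proj_val x : kspan P (val (quot_proj x) - x).
Proof. by apply/quot_projP; rewrite quot_valK. Qed.

Definition quot_add (x y : quot) := quot_proj (val x + val y).
Definition quot_opp (x : quot) := quot_proj (- val x).
Definition quot_scale c (x : quot) := quot_proj (c *: val x).

Lemma quot_addE x y : quot_add (quot_proj x) (quot_proj y) = quot_proj (x + y).
Proof.
apply/quot_projP.
rewrite (_ : _ - _ = (val (quot_proj x) - x) + (val (quot_proj y) - y)).
  by apply: kspanD; exact: quot_proj_val.
by zmod.
Qed.

Lemma quot_oppE x : quot_opp (quot_proj x) = quot_proj (- x).
Proof.
apply/quot_projP; rewrite (_ : _ - _ = - (val (quot_proj x) - x)); last by zmod.
exact/kspanN/quot_proj_val.
Qed.

Lemma quot_scaleE c x : quot_scale c (quot_proj x) = quot_proj (c *: x).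
Proof.
by apply/quot_projP; rewrite -scalerBr; exact/kspanZ/quot_proj_val.
Qed.

Lemma quot_addA : associative quot_add.
Proof.
move=> x y z; rewrite -(quot_valK x) -(quot_valK y) -(quot_valK z) !quot_addE.
by rewrite addrA.
Qed.
Lemma quot_addC : commutative quot_add.
Proof. by move=> x y; rewrite /quot_add addrC. Qed.
Lemma quot_add0 : left_id (quot_proj 0) quot_add.
Proof. by move=> x; rewrite -(quot_valK x) quot_addE add0r. Qed.
Lemma quot_addN : left_inverse (quot_proj 0) quot_opp quot_add.
Proof. by move=> x; rewrite -(quot_valK x) quot_oppE quot_addE addNr. Qed.

HB.instance Definition _ :=
  GRing.isZmodule.Build quot quot_addA quot_addC quot_add0 quot_addN.

Lemma quot_scaleA a b x : quot_scale a (quot_scale b x) = quot_scale (a * b) x.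
Proof. by rewrite -(quot_valK x) !quot_scaleE scalerA. Qed.
Lemma quot_scale1 : left_id 1 quot_scale.
Proof. by move=> x; rewrite -(quot_valK x) quot_scaleE scale1r. Qed.
Lemma quot_scaleDr : right_distributive quot_scale +%R.
Proof.
move=> c x y; rewrite -(quot_valK x) -(quot_valK y).
rewrite -[RHS]/(quot_add _ _) -[X in quot_scale _ X]/(quot_add _ _).
by rewrite quot_addE !quot_scaleE quot_addE scalerDr.
Qed.
Lemma quot_scaleDl x : {morph quot_scale^~ x : a b / a + b}.
Proof.
move=> a b; rewrite -(quot_valK x) -[RHS]/(quot_add _ _) !quot_scaleE.
by rewrite quot_addE scalerDl.
Qed.

HB.instance Definition _ := GRing.Zmodule_isLmodule.Build k quot
  quot_scaleA quot_scale1 quot_scaleDr quot_scaleDl.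

Lemma quot_proj_linear : linear quot_proj.
Proof. by move=> c x y; rewrite -quot_addE -quot_scaleE. Qed.

HB.instance Definition _ :=
  GRing.isLinear.Build k V quot _ quot_proj quot_proj_linear.

(** Turns membership in a span into the vanishing of a linear map. For the boundaries, the values of
    this map on pairs form the universal cocycle; for the relations I_R, they form the universal
    function on <R, R>. *)
Lemma kspan_quot : exists (W : lmodType k) (phi : {linear V -> W}),
  forall v, phi v = 0 <-> kspan P v.
Proof.
exists quot, quot_proj => v /=.
by rewrite -[v in kspan _ v]subr0 -quot_projP.
Qed.
End Quotient.

Section LinearExtension.
Variables (k : comNzRingType) (K : choiceType).

(** The linear extension of g from the basis of the free module. The sum in [ZHC] and the entries of
    [d2] are instances. *)
Definition mext (W : lmodType k) (g : K -> W) (v : {malg k[K]}) : W :=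
  \sum_(t <- msupp v) v@_t *: g t.

Lemma mextEw (W : lmodType k) (g : K -> W) (v : {malg k[K]}) (d : {fset K}) :
  (msupp v `<=` d)%fset -> mext g v = \sum_(t <- d) v@_t *: g t.
Proof.
move=> le; rewrite /mext; apply: big_fset_incl => // t _.
by move=> /mcoeff_outdom ->; rewrite scale0r.
Qed.

Lemma mext_linear (W : lmodType k) (g : K -> W) : linear (mext g).
Proof.
move=> c u v.
pose d := (msupp (c *: u + v) `|` (msupp u `|` msupp v))%fset.
rewrite !(@mextEw _ _ _ d); first last.
- exact: fsubsetUl.
- by apply: fsubset_trans (fsubsetUr _ _); exact: fsubsetUl.
- by apply: fsubset_trans (fsubsetUr _ _); exact: fsubsetUr.
rewrite scaler_sumr -big_split; apply: eq_bigr => t _ /=.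
by rewrite mcoeffD mcoeffZ scalerDl scalerA.
Qed.

HB.instance Definition _ (W : lmodType k) (g : K -> W) :=
  GRing.isLinear.Build k {malg k[K]} W _ (mext g) (mext_linear g).

Lemma mextD (W : lmodType k) (g : K -> W) u v : mext g (u + v) = mext g u + mext g v.
Proof. exact: (linearD (mext g)). Qed.

Lemma mextB (W : lmodType k) (g : K -> W) u v : mext g (u - v) = mext g u - mext g v.
Proof. exact: (linearB (mext g)). Qed.

Lemma mextZ (W : lmodType k) (g : K -> W) c u : mext g (c *: u) = c *: mext g u.
Proof. exact: linearZ. Qed.

Lemma mextU (W : lmodType k) (g : K -> W) t : mext g << t >> = g t.
Proof. by rewrite /mext msuppU oner_eq0 big_seq_fset1 mcoeffUU scale1r. Qed.

Lemma malg_sum (v : {malg k[K]}) : v = \sum_(t <- msupp v) v@_t *: << t >>.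
Proof.
rewrite [LHS]monalgE; apply: eq_bigr => t _; apply/malgP => u.
by rewrite mcoeffZ !mcoeffU mulr_natr.
Qed.

Lemma lin_mext (W : lmodType k) (phi : {linear {malg k[K]} -> W}) v :
  phi v = mext (fun t => phi << t >>) v.
Proof.
rewrite {1}(malg_sum v) linear_sum; apply: eq_bigr => t _.
by rewrite linearZ.
Qed.

Lemma lin_mext_mext (K' : choiceType) (W : lmodType k)
    (phi : {linear {malg k[K']} -> W}) (g : K -> {malg k[K']}) v :
  phi (mext g v) = mext (fun t => phi (g t)) v.
Proof.
by rewrite /mext linear_sum; apply: eq_bigr => t _; rewrite linearZ.
Qed.

Lemma eq_mext_in (W : lmodType k) (g h : K -> W) v :
  (forall t, t \in msupp v -> g t = h t) -> mext g v = mext h v.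
Proof.
by move=> H; rewrite /mext !big_seq; apply: eq_bigr => t /H ->.
Qed.
End LinearExtension.

(** * Pairings of opposite root spaces *)

Section RootPairing.
Variables (W : zmodType) (T : Type) (mul : T -> T -> T) (one : T).
Variables (par : T -> bool) (V : T -> Prop) (I : eqType).
(** [F i j s t] abstracts the value of a cocycle on e_ij(s) and e_ji(t), and [F_mul] its cocycle
    identity on e_il(s), e_lj(t), e_ji(u). *)
Variable F : I -> I -> T -> T -> W.
Local Notation "s ** t" := (mul s t) (at level 40, left associativity).

Hypothesis mulA : forall s t u, s ** (t ** u) = s ** t ** u.
Hypothesis mul1s : forall s, one ** s = s.
Hypothesis muls1 : forall s, s ** one = s.
Hypothesis par1 : par one = false.
Hypothesis parM : forall s t, par (s ** t) = par s (+) par t.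
Hypothesis V1 : V one.
Hypothesis VM : forall s t, V s -> V t -> V (s ** t).
Hypothesis F_anti : forall i j s t, i != j -> V s -> V t ->
  F i j s t = - sg (par s && par t) (F j i t s).
Hypothesis F_mul : forall i j l s t u, i != j -> j != l -> i != l ->
  V s -> V t -> V u ->
  F i j (s ** t) u =
  F i l s (t ** u) + sg (par s && (par t (+) par u)) (F l j t (u ** s)).

Local Notation c i j s := (F i j one s).

Let neqC (i j : I) : i != j -> j != i. Proof. by rewrite eq_sym. Qed.

(** [F_mul] with s = 1 replaces the left index; with t = 1 it replaces the right index, in the next
    lemma. *)
Lemma pairing_changel i j l t u : i != j -> j != l -> i != l -> V t -> V u ->
  F i j t u = c i l (t ** u) + F l j t u.
Proof.
move=> ij jl il Vt Vu.
by have := F_mul ij jl il V1 Vt Vu; rewrite par1 muls1 mul1s.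
Qed.

Lemma pairing_changer i j l s u : i != j -> j != l -> i != l -> V s -> V u ->
  F i j s u = F i l s u + sg (par s && par u) (c l j (u ** s)).
Proof.
move=> ij jl il Vs Vu.
by have := F_mul ij jl il Vs V1 Vu; rewrite par1 mul1s muls1.
Qed.

Lemma pairing1_add i j l s : i != j -> j != l -> i != l -> V s ->
  c i j s = c i l s + c l j s.
Proof. by move=> *; rewrite (@pairing_changel _ _ l) // mul1s. Qed.

(** Substituting c_li = c_lj + c_ji into c_lj = c_li + c_ij leaves c_ij + c_ji = 0. *)
Lemma pairing1_anti i j l s : i != j -> j != l -> i != l -> V s ->
  c i j s + c j i s = 0.
Proof.
move=> ij jl il Vs; have [ji lj li] := And3 (neqC ij) (neqC jl) (neqC il).
have H1 := pairing1_add li ij lj Vs; have H2 := pairing1_add lj ji li Vs.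
by apply: (eq_lincomb (eqD2 (eqN2 H1) (eqN2 H2))); zmod.
Qed.

Variables (o o1 : I).
Hypothesis oo1 : o1 != o.
Hypothesis third : forall i j : I, exists l, (i != l) && (j != l).

(** By additivity c_ij is a difference of potentials th_i - th_j; they are normalised by th_o = 0,
    which forces th_i = c_io. *)
Definition pairing_diag (i : I) (s : T) : W := if i == o then 0 else c i o s.
(** The remainder of F after removal of the potential. It is read off at the indices [o1], [o]; by
    [pairing_o] every other index in place of [o1] gives the same remainder. *)
Definition pairing_core (s u : T) : W := F o1 o s u - c o1 o (s ** u).
Local Notation G := pairing_core.

Lemma pairing_o i s u : i != o -> V s -> V u -> F i o s u = c i o (s ** u) + G s u.
Proof.
move=> io Vs Vu; rewrite /G.
have [->|io1] := eqVneq i o1; first by zmod.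
have Vsu := VM Vs Vu.
have H1 := pairing_changel io (neqC oo1) io1 Vs Vu.
have H2 := pairing1_add io (neqC oo1) io1 Vsu.
by rewrite H1 H2; zmod.
Qed.

Lemma pairing_neq_o i j s u : i != j -> i != o -> j != o -> V s -> V u ->
  F i j s u = c i o (s ** u) + G s u - sg (par s && par u) (c j o (u ** s)).
Proof.
move=> ij io jo Vs Vu; rewrite (pairing_changer ij jo io Vs Vu) (pairing_o io Vs Vu).
have := pairing1_anti jo (neqC io) (neqC ij) (VM Vu Vs).
case: (par s && par u) => H; rewrite /sg;
  [apply: (eq_lincomb (eqN2 H))|apply: (eq_lincomb H)]; zmod.
Qed.

(** Insert a third index l between [o1] and [o] in [F_mul] and expand all three terms; the values of
    c on stu and on tus cancel. *)
Lemma pairing_coreM s t u : V s -> V t -> V u ->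
  G (s ** t) u = G s (t ** u) + sg (par s && (par t (+) par u)) (G t (u ** s)).
Proof.
move=> Vs Vt Vu; have [l /andP[o1l ol]] := third o1 o.
have := F_mul oo1 ol o1l Vs Vt Vu.
have Vtu := VM Vt Vu; have Vst := VM Vs Vt; have Vus := VM Vu Vs.
rewrite (pairing_o oo1 Vst Vu) (pairing_neq_o o1l oo1 (neqC ol) Vs Vtu).
rewrite (pairing_o (neqC ol) Vt Vus).
rewrite !mulA parM; case: (_ && _) => H; rewrite /sg /= in H *;
  apply: (eq_lincomb H); zmod.
Qed.

Lemma pairing_core1s s : G one s = 0.
Proof. by rewrite /G mul1s subrr. Qed.

Lemma pairing_cores1 s : V s -> G s one = 0.
Proof.
move=> Vs; have [l /andP[o1l ol]] := third o1 o.
rewrite /G F_anti // par1 andbF muls1 /sg.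
have H := pairing1_anti oo1 ol o1l Vs.
by apply: (eq_lincomb (eqN2 H)); zmod.
Qed.

(** The rule [pairing_coreM] at u = 1, where the left side G(st, 1) vanishes. *)
Lemma pairing_core_anti s t : V s -> V t -> G s t = - sg (par s && par t) (G t s).
Proof.
move=> Vs Vt; have := pairing_coreM Vs Vt V1.
rewrite pairing_cores1 ?mul1s ?muls1 ?par1 ?addbF //; last exact: VM.
by case: (_ && _) => H; apply: (eq_lincomb (eqN2 H)); rewrite /sg; zmod.
Qed.

Lemma pairing_decomp i j s u : i != j -> V s -> V u ->
  F i j s u = pairing_diag i (s ** u)
    - sg (par s && par u) (pairing_diag j (u ** s)) + G s u.
Proof.
rewrite /pairing_diag => ij Vs Vu.
(* The potential at [o] is zero, and antisymmetry reduces the case i = o to [pairing_o]. *)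
have [io|io] := eqVneq i o.
  subst i; have jo := neqC ij; rewrite (negPf jo) F_anti // (pairing_o jo Vu Vs).
  rewrite (pairing_core_anti Vs Vu) andbC.
  by case: (_ && _); rewrite /sg; zmod.
have [jo|jo] := eqVneq j o.
  by subst j; rewrite (pairing_o io Vs Vu); case: (_ && _); rewrite /sg; zmod.
by rewrite pairing_neq_o //; zmod.
Qed.
End RootPairing.

(** * Homogeneous elements of R[nu] *)

Section Grading.
Variables (k : comNzRingType) (R : algType k) (Rp : bool -> R -> Prop).
Hypothesis Rg : supergrading Rp.

Lemma homogN p a : Rp p a -> Rp p (- a).
Proof. by move=> Ha; rewrite -scaleN1r; exact: sg_scale. Qed.

Lemma homogB p a b : Rp p a -> Rp p b -> Rp p (a - b).
Proof. by move=> Ha Hb; apply: sg_add => //; exact: homogN. Qed.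

Lemma homog_sg p b a : Rp p a -> Rp p (sg b a).
Proof. by case: b => //; exact: homogN. Qed.

Lemma homog_sum p (I : Type) (r : seq I) (P : pred I) (F : I -> R) :
  (forall i, P i -> Rp p (F i)) -> Rp p (\sum_(i <- r | P i) F i).
Proof. by move=> H; apply: big_ind => //; [exact: sg_0|exact: sg_add]. Qed.

Lemma homog_uniq a0 a1 b0 b1 : Rp false a0 -> Rp true a1 -> Rp false b0 ->
  Rp true b1 -> a0 + a1 = b0 + b1 -> a0 = b0 /\ a1 = b1.
Proof.
move=> Ha0 Ha1 Hb0 Hb1 E.
have E0 : a0 - b0 = b1 - a1 by apply: (eq_lincomb E); zmod.
have D0 : a0 - b0 = 0.
  by apply: (sg_direct Rg); [exact: homogB|rewrite E0; exact: homogB].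
split; first by apply/eqP; rewrite -subr_eq0 D0.
by apply/esym/eqP; rewrite -subr_eq0 -E0 D0.
Qed.

Record homog_projector (pi : bool -> R -> R) : Prop := HomogProjector {
  hproj_homog : forall p a, Rp p (pi p a);
  hproj_sum : forall a, a = pi false a + pi true a;
  hproj_lin : forall p c a b, pi p (c *: a + b) = c *: pi p a + pi p b;
  hproj_id : forall p q a, Rp p a -> pi q a = if p == q then a else 0 }.

(** The grading only asserts that components exist. Chosen by description, they depend linearly on a
    because the decomposition is unique. *)
Lemma homog_proj : exists pi, homog_projector pi.
Proof.
have ex a : exists u : R * R, [/\ Rp false u.1, Rp true u.2 & a = u.1 + u.2].
  by have [a0 [a1 H]] := sg_decomp Rg a; exists (a0, a1).
pose u a := proj1_sig (constructive_indefinite_description _ (ex a)).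
have uP a : [/\ Rp false (u a).1, Rp true (u a).2 & a = (u a).1 + (u a).2].
  exact: (proj2_sig (constructive_indefinite_description _ (ex a))).
exists (fun p a => if p then (u a).2 else (u a).1); split.
- by case=> a; have [] := uP a.
- by move=> a; have [] := uP a.
- move=> p c a b.
  have [a0 a1 Ea] := uP a; have [b0 b1 Eb] := uP b.
  have [c0 c1 Ec] := uP (c *: a + b).
  have [-> ->] : (u (c *: a + b)).1 = c *: (u a).1 + (u b).1 /\
                 (u (c *: a + b)).2 = c *: (u a).2 + (u b).2.
    apply: homog_uniq => //; try by apply: sg_add => //; apply: sg_scale.
    by rewrite -Ec {1}Ea {1}Eb scalerDr; zmod.
  by case: p.
- move=> p q a Ha; have [a0 a1 Ea] := uP a.
  have Z := sg_0 Rg.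
  have [E0 E1] : (u a).1 = (if p then 0 else a) /\
                 (u a).2 = (if p then a else 0).
    by case: p Ha => Ha; apply: homog_uniq => //; rewrite -Ea ?addr0 ?add0r.
  by rewrite E0 E1; case: p q {Ha E0 E1} => [] [].
Qed.

(* The triple (b, p, a) stands for the element a nu^b of R[nu] with a of parity
   p, where nu is odd, nu^2 = 1 and nu a = (-1)^p a nu. *)
Definition hel := (bool * bool * R)%type.
Definition hpar (s : hel) := s.1.1 (+) s.1.2.
Definition hvalid (s : hel) := Rp s.1.2 s.2.
Definition hmul (s t : hel) : hel :=
  (s.1.1 (+) t.1.1, s.1.2 (+) t.1.2, sg (s.1.1 && t.1.2) (s.2 * t.2)).
Definition hone : hel := (false, false, 1).
Definition hnu : hel := (true, false, 1).

Lemma hmulA s t u : hmul s (hmul t u) = hmul (hmul s t) u.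
Proof.
move: s t u => [[b p] a] [[c q] d] [[e r] f]; rewrite /hmul /= !addbA.
congr (_, _); case: b p c q e r => [] [] [] [] [] [] /=;
  by rewrite /sg /= ?(mulrN, mulNr) ?opprK mulrA.
Qed.
Lemma hmul1s s : hmul hone s = s.
Proof. by case: s => [[b p] a]; rewrite /hmul /= mul1r. Qed.
Lemma hmuls1 s : hmul s hone = s.
Proof. by case: s => [[b p] a]; rewrite /hmul /= !addbF andbF mulr1. Qed.
Lemma hparM s t : hpar (hmul s t) = hpar s (+) hpar t.
Proof.
by case: s t => [[b p] a] [[c q] d]; case: b p c q => [] [] [] [].
Qed.
Lemma hvalid1 : hvalid hone. Proof. exact: sg_1 Rg. Qed.
Lemma hvalid_nu : hvalid hnu. Proof. exact: sg_1 Rg. Qed.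
Lemma hvalidM s t : hvalid s -> hvalid t -> hvalid (hmul s t).
Proof. by move=> Hs Ht; apply: homog_sg; exact: sg_mul. Qed.

(** * The parts of G even and odd in nu *)

Section Core.
Variables (W : lmodType k) (half : k) (G : hel -> hel -> W).
Hypothesis halfP : 2%:R * half = 1.
Hypothesis GN1 : forall b p a t, Rp p a -> hvalid t ->
  G (b, p, - a) t = - G (b, p, a) t.
Hypothesis GN2 : forall s b p a, hvalid s -> Rp p a ->
  G s (b, p, - a) = - G s (b, p, a).
Hypothesis G1 : forall s, G hone s = 0.
Hypothesis GM : forall s t u, hvalid s -> hvalid t -> hvalid u ->
  G (hmul s t) u =
  G s (hmul t u) + sg (hpar s && (hpar t (+) hpar u)) (G t (hmul u s)).
Hypothesis G_anti : forall s t, hvalid s -> hvalid t ->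
  G s t = - sg (hpar s && hpar t) (G t s).

Lemma half_eq (x y : W) : x + x = y + y -> x = y.
Proof.
rewrite -!mulr2n -!scaler_nat => /(congr1 (fun z => half *: z)).
by rewrite !scalerA mulrC halfP !scale1r.
Qed.

Lemma half_double (x : W) : half *: x + half *: x = x.
Proof. by rewrite -scalerDl -mulr2n -mulr_natl halfP scale1r. Qed.

Lemma half_opp (x : W) : half *: (- x) = - (half *: x).
Proof. exact: scalerN. Qed.

(** In [GM] with s = t = nu and u = a nu the left side is G(1, u) = 0, and both terms on the right
    equal (-1)^p G(nu, a). *)
Lemma core_nu p a : Rp p a -> G hnu (false, p, a) = 0.
Proof.
move=> Ha; have Hc : hvalid (true, p, a) by [].
have := GM hvalid_nu hvalid_nu Hc; have := hvalid_nu.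
case: p Ha Hc => Ha Hc Hn; rewrite /hmul /hpar /sg /= -/hnu !mulr1 !mul1r G1;
  rewrite ?GN2 // => H; apply: half_eq;
  by [apply: (eq_lincomb H); zmod|apply: (eq_lincomb (eqN2 H)); zmod].
Qed.

(** Use [GM] on a, nu, b: nu crosses b with the sign (-1)^q, and the last term vanishes because
    G(nu, ba) = 0. *)
Lemma core_swap p q a b : Rp p a -> Rp q b ->
  G (true, p, a) (false, q, b) = sg q (G (false, p, a) (true, q, b)).
Proof.
move=> Ha Hb; have Hs : hvalid (false, p, a) by [].
have Hu : hvalid (false, q, b) by [].
have := GM Hs hvalid_nu Hu; have := core_nu (sg_mul Rg Hb Ha).
case: p q Ha Hb Hs Hu => [] [] Ha Hb Hs Hu;
  rewrite /hmul /hpar /sg /= -/hnu !mulr1 !mul1r => H0 ->;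
  by rewrite ?GN2 // H0; zmod.
Qed.

Definition core_diag (s : hel) : W := half *: G (true, s.1.2, s.2) hnu.

(** With antisymmetry, [GM] on a nu, nu, d and on d nu, nu, a gives two formulas for G(a, d) in
    which G(a nu, d nu) has opposite signs. Their sum yields 2 G(a, d) and their difference 2 G(a
    nu, d nu), in terms of values G(x nu, nu). *)
Lemma core_even s t : hvalid s -> hvalid t -> s.1.1 = t.1.1 ->
  G s t = core_diag (hmul s t) - sg (hpar s && hpar t) (core_diag (hmul t s)).
Proof.
move: s t => [[b p] a] [[c q] d] Hs Ht /= E; move: Ht; rewrite -{}E => Ht.
have Ha : Rp p a by []. have Hd : Rp q d by [].
have Ha0 : hvalid (false, p, a) by []. have Hd0 : hvalid (false, q, d) by [].
have Ha1 : hvalid (true, p, a) by []. have Hd1 : hvalid (true, q, d) by [].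
have Hn := hvalid_nu.
have Had := sg_mul Rg Ha Hd. have Hda := sg_mul Rg Hd Ha.
have Had1 : hvalid (true, p (+) q, a * d) by [].
have Hda1 : hvalid (true, q (+) p, d * a) by [].
have H1 := GM Ha1 Hn Hd0; have H2 := GM Hd1 Hn Ha0.
have H3 := G_anti Ha0 Hd0; have H4 := G_anti Ha1 Hd1.
have H5 := G_anti Hn Had1; have H6 := G_anti Hn Hda1.
apply: half_eq; rewrite /core_diag.
have D1 := half_double (G (true, p (+) q, a * d) hnu).
have D2 := half_double (G (true, q (+) p, d * a) hnu).
move: H1 H2 H3 H4 H5 H6 D1 D2 Had Hda Had1 Hda1.
rewrite /hmul /hpar /sg /=.
case: b p q {Hs Ht} Ha Hd Ha0 Hd0 Ha1 Hd1 => [] [] [] Ha Hd Ha0 Hd0 Ha1 Hd1 /=;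
 rewrite !mulr1 !mul1r -/hnu => H1 H2 H3 H4 H5 H6 D1 D2 Had Hda Had1 Hda1;
 rewrite ?GN1 ?GN2 // ?half_opp in H1 H2 *.
(* The values G(nu, x nu) are reversed by antisymmetry and then split into two halves, so that the
   atoms match those of [core_diag]. *)
all: rewrite {}H5 -{}D1 in H2; rewrite {}H6 -{}D2 in H1.
all: zsigns H1 ltac:(fun x1 => zsigns H2 ltac:(fun x2 => zsigns H3 ltac:(fun x3 =>
  zsigns H4 ltac:(fun x4 =>
  apply: (eq_lincomb (eqD2 (eqD2 x1 x2) (eqD2 x3 x4))); zmod)))).
Qed.

Definition core_odd (p : bool) (a : R) (q : bool) (b : R) : W :=
  G (false, p, a) (true, q, b).

Lemma core_oddE s t : hvalid s -> hvalid t -> s.1.1 != t.1.1 ->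
  G s t = sg (s.1.1 && t.1.2) (core_odd s.1.2 s.2 t.1.2 t.2).
Proof.
move: s t => [[[] p] a] [[[] q] b] //= Ha Hb _.
by rewrite core_swap.
Qed.

Lemma core_odd_anti p q a b : Rp p a -> Rp q b ->
  core_odd p a q b = - sg (p && q) (core_odd q b p a).
Proof.
move=> Ha Hb; have H := @G_anti (false, p, a) (true, q, b) Ha Hb.
rewrite /core_odd {}H core_swap // /hpar.
by case: p q {Ha Hb} => [] []; rewrite /sg /=; zmod.
Qed.

(** [GM] on a, b and c nu becomes the cyclic relation once its two terms on the right are reversed
    by [core_odd_anti]. *)
Lemma core_odd_cyc p q r a b c : Rp p a -> Rp q b -> Rp r c ->
  sg (p && r) (core_odd (p (+) q) (a * b) r c)
  + sg (q && p) (core_odd (q (+) r) (b * c) p a)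
  + sg (r && q) (core_odd (r (+) p) (c * a) q b) = 0.
Proof.
move=> Ha Hb Hc.
have H := @GM (false, p, a) (false, q, b) (true, r, c) Ha Hb Hc.
have Hbc := sg_mul Rg Hb Hc; have Hca := sg_mul Rg Hc Ha.
have H1 := core_odd_anti Ha Hbc; have H2 := core_odd_anti Hb Hca.
move: H H1 H2 Hbc Hca.
rewrite /core_odd /hmul /hpar /=.
case: p q r Ha Hb Hc => [] [] [] Ha Hb Hc; rewrite /sg /= => H H1 H2 Hbc Hca;
  rewrite ?GN1 ?GN2 // ?H1 ?H2 in H *;
  by [apply: (eq_lincomb H); zmod|apply: (eq_lincomb (eqN2 H)); zmod].
Qed.
End Core.
End Grading.

(** * The queer Lie superalgebra *)

Section Queer.
Variables (k : comNzRingType) (R : algType k) (Rp : bool -> R -> Prop).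
Hypothesis Rg : supergrading Rp.
Variable pi : bool -> R -> R.
Hypothesis piP : homog_projector Rp pi.
Variable n : nat.
Local Notation M := 'M[R]_(n + n).
Local Notation kscale := (@kscale k R n).

(** * The automorphism rho *)

Definition rho (a : R) : R := pi false a - pi true a.

Lemma rho_homog p a : Rp p a -> rho a = sg p a.
Proof.
by move=> Ha; rewrite /rho !(hproj_id piP _ Ha); case: p {Ha}; rewrite /sg /=; zmod.
Qed.

Lemma rho_lin c a b : rho (c *: a + b) = c *: rho a + rho b.
Proof. by rewrite /rho !(hproj_lin piP) scalerBr; zmod. Qed.

Lemma rho0 : rho 0 = 0.
Proof. by rewrite (rho_homog (sg_0 Rg false)). Qed.

Lemma rhoD a b : rho (a + b) = rho a + rho b.
Proof. by have := rho_lin 1 a b; rewrite !scale1r. Qed.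

Lemma rhoZ c a : rho (c *: a) = c *: rho a.
Proof. by have := rho_lin c a 0; rewrite rho0 !addr0. Qed.

Lemma rhoN a : rho (- a) = - rho a.
Proof. by rewrite -scaleN1r rhoZ scaleN1r. Qed.

Lemma rho_sum (I : Type) (r : seq I) (P : pred I) (F : I -> R) :
  rho (\sum_(i <- r | P i) F i) = \sum_(i <- r | P i) rho (F i).
Proof. by apply: (big_morph rho rhoD rho0). Qed.

Lemma rho_homogT p a : Rp p a -> Rp p (rho a).
Proof. by move=> Ha; rewrite (rho_homog Ha); exact: homog_sg. Qed.

Lemma rhoK a : rho (rho a) = a.
Proof.
rewrite {2}/rho rhoD rhoN (rho_homog (hproj_homog piP false a)).
by rewrite (rho_homog (hproj_homog piP true a)) /sg opprK -(hproj_sum piP).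
Qed.

Lemma rhoM a b : rho (a * b) = rho a * rho b.
Proof.
rewrite {1}(hproj_sum piP a) {1}(hproj_sum piP b) /rho.
rewrite !(mulrDl, mulrDr, mulNr, mulrN) -!/(rho _) !(rhoD, rhoN).
rewrite !(rho_homog (sg_mul Rg (hproj_homog piP _ _) (hproj_homog piP _ _))) /sg /=.
by zmod.
Qed.

Lemma rho_relE c b : rho_rel Rp c b <-> c = rho b.
Proof.
split=> [[b0 [b1 [H0 H1 -> ->]]]|->].
  by rewrite rhoD (rho_homog H0) (rho_homog H1).
by exists (pi false b), (pi true b); case: piP.
Qed.

(** Conjugation by nu^b. *)
Definition rb (b : bool) (a : R) : R := if b then rho a else a.

Lemma rb0 b : rb b 0 = 0. Proof. by case: b => //; exact: rho0. Qed.
Lemma rbD b x y : rb b (x + y) = rb b x + rb b y.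
Proof. by case: b => //; exact: rhoD. Qed.
Lemma rbN b x : rb b (- x) = - rb b x.
Proof. by case: b => //; exact: rhoN. Qed.
Lemma rb_homog b p a : Rp p a -> rb b a = sg (b && p) a.
Proof. by case: b => //; exact: rho_homog. Qed.
Lemma rb_homogT b p a : Rp p a -> Rp p (rb b a).
Proof. by case: b => //; exact: rho_homogT. Qed.

(** * Block indices and coefficients over R[nu] *)

Definition idx (b : bool) (i : 'I_n) : 'I_(n + n) :=
  if b then rshift n i else lshift n i.
Arguments idx : simpl never.
Definition unidx (r : 'I_(n + n)) : bool * 'I_n :=
  match fintype.split r with inl i => (false, i) | inr i => (true, i) end.

Lemma unidxK r : idx (unidx r).1 (unidx r).2 = r.
Proof. by rewrite /unidx; case: fintype.splitP => i Hi; apply: val_inj. Qed.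

Lemma idxK b i : unidx (idx b i) = (b, i).
Proof.
case: b; rewrite /unidx /idx.
  by rewrite (unsplitK (inr i)).
by rewrite (unsplitK (inl i)).
Qed.

Lemma idxP (P : 'I_(n + n) -> Prop) : (forall b i, P (idx b i)) -> forall r, P r.
Proof. by move=> H r; rewrite -(unidxK r). Qed.

Lemma ipar_idx b i : ipar (idx b i) = b.
Proof.
by case: b; rewrite /ipar /= ?leq_addr // leqNgt ltn_ord.
Qed.

Lemma sum_idx (F : 'I_(n + n) -> R) :
  \sum_r F r = \sum_i F (idx false i) + \sum_i F (idx true i).
Proof. by rewrite big_split_ord. Qed.

(** The coefficient of nu^b in the entry (i, j), when a matrix of q_n(R) is read over R[nu]. *)
Definition co (b : bool) (X : M) (i j : 'I_n) : R := X (idx false i) (idx b j).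

Lemma in_qP (X : M) : in_q Rp X <->
  forall b1 b2 i j, X (idx b1 i) (idx b2 j) = rb b1 (co (b1 (+) b2) X i j).
Proof.
split=> [H b1 b2 i j|H i j].
  case: b1 => //=; have [/rho_relE H1 /rho_relE H2] := H i j.
  by case: b2; rewrite /co /idx /= ?H1 ?H2.
by split; apply/rho_relE; [exact: (H true true)|exact: (H true false)].
Qed.

Lemma q_ext (X Y : M) : in_q Rp X -> in_q Rp Y ->
  (forall b i j, co b X i j = co b Y i j) -> X = Y.
Proof.
move=> /in_qP HX /in_qP HY H; apply/matrixP.
by apply: idxP => b i; apply: idxP => c j; rewrite HX HY H.
Qed.

Lemma coD b (X Y : M) i j : co b (X + Y) i j = co b X i j + co b Y i j.
Proof. by rewrite /co mxE. Qed.
Lemma coN b (X : M) i j : co b (- X) i j = - co b X i j.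
Proof. by rewrite /co mxE. Qed.
Lemma co0 b i j : co b 0 i j = 0. Proof. by rewrite /co mxE. Qed.
Lemma coZ b c X i j : co b (kscale c X) i j = c *: co b X i j.
Proof. by rewrite /co mxE. Qed.
Lemma co_sum b (I : Type) (r : seq I) (P : pred I) (F : I -> M) i j :
  co b (\sum_(t <- r | P t) F t) i j = \sum_(t <- r | P t) co b (F t) i j.
Proof. by rewrite /co summxE. Qed.

(** Multiplication of x0 + x1 nu by y0 + y1 nu: moving nu across a coefficient of Y applies rho. *)
Lemma coM b (X Y : M) i j : in_q Rp Y -> co b (X *m Y) i j =
  \sum_l (co false X i l * co b Y l j + co true X i l * rho (co (~~ b) Y l j)).
Proof.
move=> /in_qP HY; rewrite {1}/co mxE sum_idx big_split.
by congr (_ + _); apply: eq_bigr => l _; rewrite HY.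
Qed.

Lemma in_q0 : in_q Rp (0 : M).
Proof. by apply/in_qP => b1 b2 i j; rewrite mxE co0 rb0. Qed.
Lemma in_qD (X Y : M) : in_q Rp X -> in_q Rp Y -> in_q Rp (X + Y).
Proof.
move=> /in_qP HX /in_qP HY; apply/in_qP => b1 b2 i j.
by rewrite mxE HX HY coD rbD.
Qed.
Lemma in_qN (X : M) : in_q Rp X -> in_q Rp (- X).
Proof. by move=> /in_qP HX; apply/in_qP => b1 b2 i j; rewrite mxE HX coN rbN. Qed.
Lemma in_qZ c X : in_q Rp X -> in_q Rp (kscale c X).
Proof.
move=> /in_qP HX; apply/in_qP => b1 b2 i j; rewrite mxE HX coZ.
by case: b1 => //=; rewrite rhoZ.
Qed.
Lemma in_qM (X Y : M) : in_q Rp X -> in_q Rp Y -> in_q Rp (X *m Y).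
Proof.
move=> HX HY; apply/in_qP => b1 b2 i j; rewrite (coM _ _ _ _ HY).
move/in_qP: HX => HX; move/in_qP: HY => HY.
case: b1; last first.
  by rewrite mxE sum_idx big_split; congr (_ + _); apply: eq_bigr => l _; rewrite HY.
rewrite mxE sum_idx big_split [LHS]addrC /= rhoD !rho_sum.
by congr (_ + _); apply: eq_bigr => l _; rewrite !HX ?HY rhoM // rhoK negbK.
Qed.
Lemma in_q_sum (I : Type) (r : seq I) (P : pred I) (F : I -> M) :
  (forall i, P i -> in_q Rp (F i)) -> in_q Rp (\sum_(i <- r | P i) F i).
Proof. by move=> H; apply: big_ind => //; [exact: in_q0|exact: in_qD]. Qed.

Lemma sbrE p q (X Y : M) : sbr p q X Y = X *m Y - sg (p && q) (Y *m X).
Proof. by rewrite /sbr /sg; case: (_ && _); rewrite ?opprK. Qed.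

Lemma in_q_sg b (X : M) : in_q Rp X -> in_q Rp (sg b X).
Proof. by case: b => //; exact: in_qN. Qed.

Lemma in_q_sbr p q (X Y : M) : in_q Rp X -> in_q Rp Y -> in_q Rp (sbr p q X Y).
Proof.
move=> HX HY; rewrite sbrE; apply: in_qD; first exact: in_qM.
exact/in_qN/in_q_sg/in_qM.
Qed.

Local Notation mxh := (mx_homog Rp (n := n)).

Lemma mxh0 p : mxh p 0. Proof. by move=> i j; rewrite mxE; exact: sg_0. Qed.
Lemma mxhD p X Y : mxh p X -> mxh p Y -> mxh p (X + Y).
Proof. by move=> HX HY i j; rewrite mxE; exact: sg_add. Qed.
Lemma mxhN p X : mxh p X -> mxh p (- X).
Proof. by move=> HX i j; rewrite mxE; exact: homogN. Qed.
Lemma mxhZ p c X : mxh p X -> mxh p (kscale c X).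
Proof. by move=> HX i j; rewrite mxE; exact: sg_scale. Qed.
Lemma mxhM p q X Y : mxh p X -> mxh q Y -> mxh (p (+) q) (X *m Y).
Proof.
move=> HX HY i j; rewrite mxE; apply: homog_sum => // l _.
have := sg_mul Rg (HX i l) (HY l j).
by move: (ipar i) (ipar j) (ipar l) p q {HX HY} => [] [] [] [] [].
Qed.
Lemma mxh_sbr p q X Y : mxh p X -> mxh q Y -> mxh (p (+) q) (sbr p q X Y).
Proof.
move=> HX HY; rewrite sbrE; apply: mxhD; first exact: mxhM.
by apply: mxhN; case: (p && q) => /=; [apply: mxhN|]; rewrite addbC; apply: mxhM.
Qed.
Lemma mxh_co p X b i j : mxh p X -> Rp (p (+) b) (co b X i j).
Proof. by move=> /(_ (idx false i) (idx b j)); rewrite !ipar_idx addbF. Qed.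

(** * Matrix units *)

Definition emx (i j : 'I_n) (b : bool) (a : R) : M := \matrix_(r, s)
  if [&& (unidx r).1 (+) (unidx s).1 == b, (unidx r).2 == i & (unidx s).2 == j]
  then rb (unidx r).1 a else 0.

Lemma co_emx i j b a c i' j' :
  co c (emx i j b a) i' j' = if [&& c == b, i' == i & j' == j] then a else 0.
Proof. by rewrite /co mxE !idxK. Qed.

Lemma emx_q i j b a : in_q Rp (emx i j b a).
Proof.
apply/in_qP => b1 b2 i' j'; rewrite co_emx mxE !idxK /=.
by case: ifP => _; rewrite ?rb0.
Qed.

Lemma emx_homog i j b p a : Rp p a -> mxh (b (+) p) (emx i j b a).
Proof.
move=> Ha; apply: idxP => b1 i'; apply: idxP => b2 j'.
rewrite mxE !idxK !ipar_idx /=; case: ifP => [/and3P[/eqP <- _ _]|_].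
  have -> : b1 (+) b2 (+) p (+) b1 (+) b2 = p by case: b1 b2 p {Ha} => [] [] [].
  exact: rb_homogT.
exact: sg_0.
Qed.

Lemma emx0 i j b : emx i j b 0 = 0.
Proof. by apply/matrixP => r s; rewrite !mxE rb0 if_same. Qed.
Lemma emxD i j b x y : emx i j b (x + y) = emx i j b x + emx i j b y.
Proof. by apply/matrixP => r s; rewrite !mxE rbD; case: ifP => _; rewrite ?addr0. Qed.
Lemma emxN i j b x : emx i j b (- x) = - emx i j b x.
Proof. by apply/matrixP => r s; rewrite !mxE rbN; case: ifP => _; rewrite ?oppr0. Qed.
Lemma emxZ i j b c x : emx i j b (c *: x) = kscale c (emx i j b x).
Proof.
apply/matrixP => r s; rewrite !mxE; case: ifP => _; rewrite ?scaler0 //.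
by case: (unidx r).1 => //=; rewrite rhoZ.
Qed.
Lemma emx_sg i j b c x : emx i j b (sg c x) = sg c (emx i j b x).
Proof. by case: c => //; exact: emxN. Qed.

Lemma emx_mul i j b a l m c d : emx i j b a *m emx l m c d =
  if j == l then emx i m (b (+) c) (a * rb b d) else 0.
Proof.
apply: q_ext => [||e i' j'].
- by apply: in_qM; exact: emx_q.
- by case: ifP => _; [exact: emx_q|exact: in_q0].
rewrite coM; last exact: emx_q.
under eq_bigr => h _ do rewrite !co_emx.
have [jl|jl] := eqVneq j l; last first.
  rewrite co0 big1 // => h _.
  have [->|hl] := eqVneq h l.
    by rewrite [l == j]eq_sym (negPf jl) !andbF !mul0r addr0.
  by rewrite !andbF rho0 !mulr0 addr0.
subst l; rewrite (bigD1 j) //= big1 ?addr0 => [|h /negPf hj]; last first.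
  by rewrite hj /= !andbF rho0 !mulr0 addr0.
rewrite eqxx !andbT co_emx.
case: (i' == i); rewrite /= ?andbF ?mul0r ?addr0 //.
case: (j' == m); rewrite /= ?andbF ?rho0 ?mulr0 ?addr0 // !andbT.
by case: b c e => [] [] []; rewrite /= ?rho0 ?mul0r ?mulr0 ?addr0 ?add0r.
Qed.

Lemma q_decomp (X : M) : in_q Rp X ->
  X = \sum_i \sum_j (emx i j false (co false X i j) + emx i j true (co true X i j)).
Proof.
move=> HX; apply: q_ext => // [|b i j].
  by do 2![apply: in_q_sum => ? _]; apply: in_qD; exact: emx_q.
rewrite co_sum (bigD1 i) //= co_sum (bigD1 j) //= coD !co_emx !eqxx !andbT.
rewrite !big1 ?addr0 => [|i' /negPf ii|j' /negPf jj].
- by case: b; rewrite /= ?addr0 ?add0r.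
- rewrite co_sum big1 // => j' _.
  by rewrite coD !co_emx [i == i']eq_sym ii !andbF addr0.
by rewrite coD !co_emx [j == j']eq_sym jj !andbF addr0.
Qed.

Definition eh (i j : 'I_n) (s : hel R) : M := emx i j s.1.1 s.2.
Local Notation hvalid := (hvalid Rp).

Lemma eh_q i j s : in_q Rp (eh i j s). Proof. exact: emx_q. Qed.
Lemma eh_homog i j s : hvalid s -> mxh (hpar s) (eh i j s).
Proof. exact: emx_homog. Qed.

Lemma eh_mul i j s l m t : hvalid t ->
  eh i j s *m eh l m t = if j == l then eh i m (hmul s t) else 0.
Proof.
move=> Ht; rewrite emx_mul (rb_homog _ Ht) /eh /=.
by case: s.1.1 t.1.2 => [] []; rewrite /= ?mulrN.
Qed.

Lemma eh_br i j s l m t : hvalid s -> hvalid t ->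
  sbr (hpar s) (hpar t) (eh i j s) (eh l m t) =
  (if j == l then eh i m (hmul s t) else 0)
  - sg (hpar s && hpar t) (if m == i then eh l j (hmul t s) else 0).
Proof. by move=> Hs Ht; rewrite sbrE !eh_mul. Qed.

(** * The derived subalgebra *)

Local Notation gh := (sq_homog Rp (n := n)).

Lemma in_sq_gen p q (X Y : M) : in_q Rp X -> in_q Rp Y -> mxh p X -> mxh q Y ->
  in_sq Rp (sbr p q X Y).
Proof.
move=> qX qY hX hY; exists [:: (1, sbr p q X Y)]; split.
  by move=> t [<-|[]]; exists p, q, X, Y.
by rewrite big_seq1; apply/matrixP => i j; rewrite !mxE scale1r.
Qed.

Lemma in_sq0 : in_sq Rp (0 : M).
Proof. by exists [::]; split => //; rewrite big_nil. Qed.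

Lemma in_sqD (X Y : M) : in_sq Rp X -> in_sq Rp Y -> in_sq Rp (X + Y).
Proof.
move=> [l [Hl ->]] [m [Hm ->]]; exists (l ++ m); split; last by rewrite big_cat.
by move=> t Ht; case: (List.in_app_or _ _ _ Ht) => [/Hl|/Hm].
Qed.

Lemma kscaleA c d (X : M) : kscale c (kscale d X) = kscale (c * d) X.
Proof. by apply/matrixP => i j; rewrite !mxE scalerA. Qed.
Lemma kscaleD c (X Y : M) : kscale c (X + Y) = kscale c X + kscale c Y.
Proof. by apply/matrixP => i j; rewrite !mxE scalerDr. Qed.
Lemma kscaler0 c : kscale c 0 = 0.
Proof. by apply/matrixP => i j; rewrite !mxE scaler0. Qed.
Lemma kscale1 (X : M) : kscale 1 X = X.
Proof. by apply/matrixP => i j; rewrite !mxE scale1r. Qed.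
Lemma kscaleN1 (X : M) : kscale (-1) X = - X.
Proof. by apply/matrixP => i j; rewrite !mxE scaleN1r. Qed.

Lemma in_sqZ c X : in_sq Rp X -> in_sq Rp (kscale c X).
Proof.
move=> [l [Hl ->]]; exists [seq (c * t.1, t.2) | t <- l]; split.
  by move=> t Ht; have [t' [<- /Hl]] := proj1 (List.in_map_iff _ _ _) Ht.
rewrite big_map; elim: (l) => [|t l' IH]; first by rewrite !big_nil kscaler0.
by rewrite !big_cons kscaleD kscaleA IH.
Qed.

Lemma in_sq_q (X : M) : in_sq Rp X -> in_q Rp X.
Proof.
move=> [l [Hl ->]]; elim: l Hl => [|t l IH] Hl; first by rewrite big_nil; exact: in_q0.
rewrite big_cons; apply: in_qD; last by apply: IH => u Hu; apply: Hl; right.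
apply: in_qZ; have [|p [q [X1 [X2 [q1 q2 _ _ ->]]]]] := Hl t; first by left.
exact: in_q_sbr.
Qed.

Lemma gh0 p : gh p 0. Proof. by split; [exact: in_sq0|exact: mxh0]. Qed.
Lemma ghD p X Y : gh p X -> gh p Y -> gh p (X + Y).
Proof. by move=> [? ?] [? ?]; split; [exact: in_sqD|exact: mxhD]. Qed.
Lemma ghZ p c X : gh p X -> gh p (kscale c X).
Proof. by move=> [? ?]; split; [exact: in_sqZ|exact: mxhZ]. Qed.
Lemma ghN p X : gh p X -> gh p (- X).
Proof. by rewrite -kscaleN1; exact: ghZ. Qed.
Lemma gh_br p q X Y : gh p X -> gh q Y -> gh (p (+) q) (sbr p q X Y).
Proof.
move=> [sX hX] [sY hY]; split; last exact: mxh_sbr.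
by apply: in_sq_gen => //; exact: in_sq_q.
Qed.

(** The idempotent e_ii(1) of q_n(R) acts on e_ij(s) with weight 1, so e_ij(s) is a commutator. *)
Lemma gh_eh i j s : i != j -> hvalid s -> gh (hpar s) (eh i j s).
Proof.
move=> ij Hs; split; last exact: eh_homog.
have H1 := hvalid1 Rg.
have <- : sbr (hpar (hone R)) (hpar s) (eh i i (hone R)) (eh i j s) = eh i j s.
  by rewrite eh_br // eqxx [j == i]eq_sym (negPf ij) hmul1s /= subr0.
by apply: in_sq_gen; by [exact: eh_q|exact: eh_homog].
Qed.

Variable half : k.
Hypothesis halfP : 2%:R * half = 1.

Lemma kscale_half (X : M) : kscale half (X + X) = X.
Proof.
apply/matrixP => i j; rewrite !mxE scalerDr -scalerDl -mulr2n -mulr_natl halfP.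
by rewrite scale1r.
Qed.

Lemma gh_eh1 i : gh false (eh i i (hone R)).
Proof.
split; last by apply: (@eh_homog i i (hone R)); exact: hvalid1.
have Hn := hvalid_nu Rg; rewrite -[eh _ _ _]kscale_half; apply: in_sqZ.
have <- : sbr true true (eh i i (hnu R)) (eh i i (hnu R)) =
          eh i i (hone R) + eh i i (hone R).
  rewrite (@eh_br i i (hnu R) i i (hnu R)) // eqxx /sg /= opprK.
  by rewrite /hmul /= mulr1.
by apply: in_sq_gen; try exact: eh_q; apply: (@eh_homog i i (hnu R)).
Qed.
End Queer.

Lemma sq_homog_sbr (k : comNzRingType) (R : algType k) (Rp : bool -> R -> Prop)
    (n p q : _) (X Y : 'M[R]_(n + n)) : supergrading Rp ->
  sq_homog Rp p X -> sq_homog Rp q Y -> sq_homog Rp (p (+) q) (sbr p q X Y).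
Proof.
by move=> Rg hX hY; have [pi piP] := homog_proj Rg; exact: (gh_br Rg piP).
Qed.

(** * Bilinear relations *)

Lemma eq_of_comb3 (W : zmodType) (a b c : W) : a - b + c = 0 -> a = b - c.
Proof. by move=> E; apply: (eq_lincomb E); zmod. Qed.

Section TensorKernel.
Variables (k : comNzRingType) (T : choiceType) (add : T -> T -> T).
Variables (sc : k -> T -> T) (h : bool -> T -> Prop) (W : lmodType k).

Definition unc2 (V : Type) (g : bool -> T -> bool -> T -> V)
  (t : (bool * T) * (bool * T)) : V := g t.1.1 t.1.2 t.2.1 t.2.2.

Lemma mext_e2 (g : bool -> T -> bool -> T -> W) p x q y :
  mext (unc2 g) (e2 k p x q y) = g p x q y.
Proof. exact: mextU. Qed.

Lemma mext_e2_comb3 (g : bool -> T -> bool -> T -> W) c d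
    p x q y p' x' q' y' p'' x'' q'' y'' :
  mext (unc2 g) (e2 k p x q y - c *: e2 k p' x' q' y' + d *: e2 k p'' x'' q'' y'')
  = g p x q y - c *: g p' x' q' y' + d *: g p'' x'' q'' y''.
Proof. by rewrite (lin_comb3 (mext (unc2 g))) /= !mext_e2. Qed.

Lemma mext_e2B (g : bool -> T -> bool -> T -> W) p x q y p' x' q' y' :
  mext (unc2 g) (e2 k p x q y - e2 k p' x' q' y') = g p x q y - g p' x' q' y'.
Proof. by rewrite (linearB (mext (unc2 g))) /= !mext_e2. Qed.

(** The conditions on homogeneous arguments under which the linear extension of g kills [sbil_rel];
    conversely, a linear map killing these relations restricts to such a g. *)
Record sbilinear (g : bool -> T -> bool -> T -> W) : Prop := SBilinear {
  sbil_D1 : forall p q x x' y, h p x -> h p x' -> h q y ->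
    g p (add x x') q y = g p x q y + g p x' q y;
  sbil_D2 : forall p q x y y', h p x -> h q y -> h q y' ->
    g p x q (add y y') = g p x q y + g p x q y';
  sbil_Z1 : forall c p q x y, h p x -> h q y ->
    g p (sc c x) q y = c *: g p x q y;
  sbil_Z2 : forall c p q x y, h p x -> h q y ->
    g p x q (sc c y) = c *: g p x q y;
  sbil_anti : forall p q x y, h p x -> h q y ->
    g p x q y = - sg (p && q) (g q y p x) }.

Definition sbil_rel v := bilin_rel add sc h v \/ @santisym_rel k T h v.

Lemma sbilinear_mext g : sbilinear g ->
  forall v, sbil_rel v -> mext (unc2 g) v = 0.
Proof.
move=> [D1 D2 Z1 Z2 A] v.
case=> [[|[|[|]]]|].
- move=> [p [q [x [x' [y [hx hx' hy ->]]]]]].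
  by rewrite !mextB !mext_e2 D1 //; zmod.
- move=> [p [q [x [y [y' [hx hy hy' ->]]]]]].
  by rewrite !mextB !mext_e2 D2 //; zmod.
- move=> [c [p [q [x [y [hx hy ->]]]]]].
  by rewrite mextB mextZ !mext_e2 Z1 // subrr.
- move=> [c [p [q [x [y [hx hy ->]]]]]].
  by rewrite mextB mextZ !mext_e2 Z2 // subrr.
- move=> [p [q [x [y [hx hy ->]]]]].
  by rewrite mextD mextZ /= !mext_e2 sgnZ A // addNr.
Qed.

Lemma sbilinear_lin (phi : {linear {malg k[((bool * T) * (bool * T))%type]} -> W}) :
  (forall v, sbil_rel v -> phi v = 0) ->
  sbilinear (fun p x q y => phi (e2 k p x q y)).
Proof.
move=> H; split.
- move=> p q x x' y hx hx' hy.
  have: phi (e2 k p (add x x') q y - e2 k p x q y - e2 k p x' q y) = 0.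
    by apply: H; left; left; exists p, q, x, x', y.
  by rewrite !(linearB phi) /= => E; apply: (eq_lincomb E); zmod.
- move=> p q x y y' hx hy hy'.
  have: phi (e2 k p x q (add y y') - e2 k p x q y - e2 k p x q y') = 0.
    by apply: H; left; right; left; exists p, q, x, y, y'.
  by rewrite !(linearB phi) /= => E; apply: (eq_lincomb E); zmod.
- move=> c p q x y hx hy.
  have: phi (e2 k p (sc c x) q y - c *: e2 k p x q y) = 0.
    by apply: H; left; right; right; left; exists c, p, q, x, y.
  by rewrite (linearB phi) linearZ /= => /eqP; rewrite subr_eq0 => /eqP.
- move=> c p q x y hx hy.
  have: phi (e2 k p x q (sc c y) - c *: e2 k p x q y) = 0.
    by apply: H; left; right; right; right; exists c, p, q, x, y.
  by rewrite (linearB phi) linearZ /= => /eqP; rewrite subr_eq0 => /eqP.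
- move=> p q x y hx hy.
  have: phi (e2 k p x q y + sgn k (p && q) *: e2 k q y p x) = 0.
    by apply: H; right; exists p, q, x, y.
  by rewrite (linearD phi) linearZ /= sgnZ => /eqP; rewrite addr_eq0 => /eqP.
Qed.
End TensorKernel.

(** * Cocycles on the special queer Lie superalgebra *)

Section Cocycle.
Variables (k : comNzRingType) (R : algType k) (Rp : bool -> R -> Prop).
Hypothesis Rg : supergrading Rp.
Variables (n : nat) (W : lmodType k).
Local Notation M := 'M[R]_(n + n).
Local Notation gh := (sq_homog Rp (n := n)).
Local Notation kscale := (@kscale k R n).

Definition sjacobi (g : bool -> M -> bool -> M -> W) : Prop :=
  forall p q r X Y Z, gh p X -> gh q Y -> gh r Z ->
  g (p (+) q) (sbr p q X Y) r Z = sg (q && r) (g (p (+) r) (sbr p r X Z) q Y)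
    - sg (p && (q (+) r)) (g (q (+) r) (sbr q r Y Z) p X).

Definition scocycle g := sbilinear (fun X Y : M => X + Y) kscale gh g /\ sjacobi g.

Definition B2_gen (v : {malg k[((bool * M) * (bool * M))%type]}) :=
  bilin_rel +%R kscale gh v \/ santisym_rel gh v \/ @d3_gen k R Rp n v.

Lemma scocycle_mext g : scocycle g -> forall v, B2_gen v -> mext (unc2 g) v = 0.
Proof.
move=> [gb gj] v [H|[H|]].
- by apply: (sbilinear_mext gb); left.
- by apply: (sbilinear_mext gb); right.
move=> [p [q [r [X [Y [Z [hX hY hZ ->]]]]]]].
rewrite mext_e2_comb3 !sgnZ (gj _ _ _ _ _ _ hX hY hZ).
by zmod.
Qed.

Lemma scocycle_lin (phi : {linear {malg k[((bool * M) * (bool * M))%type]} -> W}) :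
  (forall v, B2_gen v -> phi v = 0) ->
  scocycle (fun p X q Y => phi (e2 k p X q Y)).
Proof.
move=> H; split.
  by apply: sbilinear_lin => v [Hv|Hv]; apply: H; [left|right; left].
move=> p q r X Y Z hX hY hZ.
have: phi (e2 k (p (+) q) (sbr p q X Y) r Z
        - sgn k (q && r) *: e2 k (p (+) r) (sbr p r X Z) q Y
        + sgn k (p && (q (+) r)) *: e2 k (q (+) r) (sbr q r Y Z) p X) = 0.
  by apply: H; right; right; exists p, q, r, X, Y, Z.
rewrite (lin_comb3 phi) !sgnZ; exact: eq_of_comb3.
Qed.

Lemma scocycleB g1 g2 : scocycle g1 -> scocycle g2 ->
  scocycle (fun p X q Y => g1 p X q Y - g2 p X q Y).
Proof.
move=> [[D1 D2 Z1 Z2 A] J] [[D1' D2' Z1' Z2' A'] J']; split; first split.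
- by move=> p q x x' y *; rewrite D1 // D1' //; zmod.
- by move=> p q x x' y *; rewrite D2 // D2' //; zmod.
- by move=> c p q x y *; rewrite Z1 // Z1' // scalerBr.
- by move=> c p q x y *; rewrite Z2 // Z2' // scalerBr.
- by move=> p q x y *; rewrite A // A' //; case: (_ && _); rewrite /sg; zmod.
- move=> p q r X Y Z *; rewrite J // J' //.
  by case: (_ && _); case: (_ && _); rewrite /sg; zmod.
Qed.

Section Basic.
Variable g : bool -> M -> bool -> M -> W.
Hypothesis gc : scocycle g.

Lemma coc_0l p q Y : gh q Y -> g p 0 q Y = 0.
Proof.
move=> hY; have := sbil_Z1 gc.1 0 (gh0 Rg n p) hY.
by rewrite scale0r => E; rewrite -{1}E; congr g; apply/matrixP => i j;
  rewrite !mxE scale0r.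
Qed.

Lemma coc_anti p q X Y : gh p X -> gh q Y ->
  g p X q Y = - sg (p && q) (g q Y p X).
Proof. by move=> hX hY; apply: (sbil_anti gc.1). Qed.

Lemma coc_0r p q X : gh p X -> g p X q 0 = 0.
Proof.
move=> hX; rewrite coc_anti // ?coc_0l //; last exact: gh0.
by case: (_ && _); rewrite /sg ?oppr0.
Qed.

Lemma coc_Nl p q X Y : gh p X -> gh q Y -> g p (- X) q Y = - g p X q Y.
Proof.
by move=> hX hY; rewrite -kscaleN1 (sbil_Z1 gc.1) // scaleN1r.
Qed.

Lemma coc_sgl p q b X Y : gh p X -> gh q Y -> g p (sg b X) q Y = sg b (g p X q Y).
Proof. by case: b => // *; rewrite /sg coc_Nl. Qed.

(** The cocycle identity with an even first argument H: g is invariant under ad H up to a value of g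
    at H. On weight vectors of H the left side is the sum of the weights times g(X, Y). *)
Lemma coc_ad p q H X Y : gh false H -> gh p X -> gh q Y ->
  g p (sbr false p H X) q Y + g p X q (sbr false q H Y) =
  g false H (p (+) q) (sbr p q X Y).
Proof.
move=> hH hX hY; have := gc.2 false p q H X Y hH hX hY; rewrite /= => ->.
have hHY := sq_homog_sbr Rg hH hY; have hXY := sq_homog_sbr Rg hX hY.
rewrite (coc_anti hX hHY) (coc_anti hH hXY) /=.
by case: (_ && _); rewrite /sg; zmod.
Qed.
End Basic.
End Cocycle.

(** * Generation by root vectors and rigidity *)

Section Rigidity.
Variables (k : comNzRingType) (R : algType k) (Rp : bool -> R -> Prop).
Hypothesis Rg : supergrading Rp.
Variable pi : bool -> R -> R.
Hypothesis piP : homog_projector Rp pi.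
Variable half : k.
Hypothesis halfP : 2%:R * half = 1.
Variable n : nat.
Hypothesis n2 : (1 < n)%N.
Local Notation M := 'M[R]_(n + n).
Local Notation kscale := (@kscale k R n).
Local Notation gh := (sq_homog Rp (n := n)).
Local Notation mxh := (mx_homog Rp (n := n)).
Local Notation hvalid := (hvalid Rp).
Local Notation eh := (@eh k R pi n).
Local Notation ebr i j s l m t :=
  (sbr (hpar s) (hpar t) (eh i j s) (eh l m t)).
Let eh_br := eh_br Rg piP.
Let eh_mul := eh_mul Rg piP.

(** Root vectors, and brackets of opposite ones, which supply the diagonal part of sq_n(R). *)
Definition root_gen (p : bool) (X : M) : Prop :=
  (exists i j s, [/\ i != j, hvalid s, hpar s = p & X = eh i j s]) \/
  (exists i j s t, [/\ i != j, hvalid s, hvalid t, hpar s (+) hpar t = p &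
     X = ebr i j s j i t]).

(** The parity is fixed along the construction, so every intermediate sum is homogeneous and the
    bilinearity of a cocycle applies to it. *)
Inductive root_span (p : bool) : M -> Prop :=
  | RootGen X of root_gen p X : root_span p X
  | Root0 : root_span p 0
  | RootD X Y of root_span p X & root_span p Y : root_span p (X + Y)
  | RootZ c X of root_span p X : root_span p (kscale c X).

Lemma root_gen_gh p X : root_gen p X -> gh p X.
Proof.
case=> [[i [j [s [ij hs <- ->]]]]|[i [j [s [t [ij hs ht <- ->]]]]]].
  exact: (gh_eh Rg piP).
by apply: sq_homog_sbr => //; apply: (gh_eh Rg piP) => //; rewrite eq_sym.
Qed.

Lemma root_span_gh p X : root_span p X -> gh p X.
Proof.
elim=> [Y /root_gen_gh //||Y Z _ hY _ hZ|c Y _ hY].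
- exact: gh0.
- exact: ghD.
- exact: ghZ.
Qed.

Lemma root_spanN p X : root_span p X -> root_span p (- X).
Proof. by move=> H; rewrite -kscaleN1; exact: RootZ. Qed.

Lemma root_span_sg p b X : root_span p X -> root_span p (sg b X).
Proof. by case: b => //; exact: root_spanN. Qed.

Lemma other_index (i : 'I_n) : exists j, i != j.
Proof.
have n0 : (0 < n)%N by apply: ltnW.
case: (eqVneq i (Ordinal n0)) => [->|]; last by exists (Ordinal n0).
by exists (Ordinal n2).
Qed.

Lemma root_span_eh p i j s : i != j -> hvalid s -> hpar s = p ->
  root_span p (eh i j s).
Proof. by move=> ij hs hp; apply: RootGen; left; exists i, j, s. Qed.

Lemma root_span_ebr i j s l m t : hvalid s -> hvalid t ->
  root_span (hpar s (+) hpar t) (ebr i j s l m t).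
Proof.
move=> hs ht.
have hst := hvalidM Rg hs ht; have hts := hvalidM Rg ht hs.
have [jl|jl] := eqVneq j l; have [mi|mi] := eqVneq m i.
- subst l m; have [ij|ij] := eqVneq i j; last first.
    by apply: RootGen; right; exists i, j, s, t.
  (* [e_ii(s), e_ii(t)] = [e_im(s), e_mi(t)] -+ [e_im(ts), e_mi(1)] *)
  subst j; have [m im] := other_index i; have mi : m != i by rewrite eq_sym.
  have h1 := hvalid1 Rg.
  have -> : ebr i i s i i t = ebr i m s m i t
      - sg (hpar s && hpar t) (ebr i m (hmul t s) m i (hone R)).
    rewrite !eh_br // !eqxx hmuls1 hmul1s andbF.
    by case: (_ && _); rewrite /sg; zmod.
  apply: RootD; first by apply: RootGen; right; exists i, m, s, t.
  apply: root_spanN; apply: root_span_sg.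
  apply: RootGen; right; exists i, m, (hmul t s), (hone R); split=> //.
  by rewrite hparM addbF addbC.
- subst l; rewrite eh_br // eqxx (negPf mi) sg0 subr0.
  by apply: root_span_eh; rewrite ?hparM // eq_sym.
- subst m; rewrite eh_br // eqxx (negPf jl) sub0r.
  apply: root_spanN; apply: root_span_sg.
  by apply: root_span_eh; rewrite ?hparM 1?addbC // eq_sym.
- rewrite eh_br // (negPf mi) (negPf jl) sg0 subr0.
  exact: Root0.
Qed.

Lemma q_homog_ind p (P : M -> Prop) : P 0 ->
  (forall X Y, P X -> P Y -> P (X + Y)) ->
  (forall i j s, hvalid s -> hpar s = p -> P (eh i j s)) ->
  forall X, in_q Rp X -> mxh p X -> P X.
Proof.
move=> P0 PD PE X qX hX; rewrite (q_decomp Rg piP qX).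
apply: big_ind => // i _; apply: big_ind => // j _; apply: PD.
  apply: (PE i j (false, p, co false X i j)) => //.
  by have := mxh_co false i j hX; rewrite addbF.
apply: (PE i j (true, ~~ p, co true X i j)); last by rewrite /hpar /= negbK.
by have := mxh_co true i j hX; rewrite addbT.
Qed.

Lemma sbrDl p q (X Y Z : M) : sbr p q (X + Y) Z = sbr p q X Z + sbr p q Y Z.
Proof.
rewrite !sbrE mulmxDl mulmxDr; case: (_ && _); rewrite /sg; zmod.
Qed.

Lemma sbrDr p q (X Y Z : M) : sbr p q Z (X + Y) = sbr p q Z X + sbr p q Z Y.
Proof.
rewrite !sbrE mulmxDl mulmxDr; case: (_ && _); rewrite /sg; zmod.
Qed.

Lemma sbr0l p q (Z : M) : sbr p q 0 Z = 0.
Proof. by rewrite sbrE mul0mx mulmx0 sg0 subr0. Qed.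

Lemma sbr0r p q (Z : M) : sbr p q Z 0 = 0.
Proof. by rewrite sbrE mul0mx mulmx0 sg0 subr0. Qed.

Lemma root_span_sbr p q X Y : in_q Rp X -> in_q Rp Y -> mxh p X -> mxh q Y ->
  root_span (p (+) q) (sbr p q X Y).
Proof.
move=> qX qY hX hY; move: X qX hX; apply: q_homog_ind.
- by rewrite sbr0l; exact: Root0.
- by move=> X X' HX HX'; rewrite sbrDl; exact: RootD.
move=> i j s hs <-; move: Y qY hY; apply: q_homog_ind.
- by rewrite sbr0r; exact: Root0.
- by move=> X X' HX HX'; rewrite sbrDr; exact: RootD.
by move=> l m t ht <-; exact: root_span_ebr.
Qed.

Lemma mxh_direct X : mxh false X -> mxh true X -> X = 0.
Proof.
move=> h0 h1; apply/matrixP => i j; rewrite mxE; apply: (sg_direct Rg).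
  by have := h0 i j; have := h1 i j; case: (ipar i) (ipar j) => [] [].
by have := h0 i j; have := h1 i j; case: (ipar i) (ipar j) => [] [].
Qed.

Lemma in_sq_root_span (X : M) : in_sq Rp X ->
  exists X0 X1, [/\ root_span false X0, root_span true X1 & X = X0 + X1].
Proof.
move=> [l [Hl ->]]; elim: l Hl => [|[c Y] l IH] Hl.
  by exists 0, 0; rewrite big_nil addr0; split; try exact: Root0.
have [|X0 [X1 [h0 h1 E]]] := IH; first by move=> u Hu; apply: Hl; right.
have [|p [q [Y1 [Y2 [q1 q2 m1 m2 EY]]]]] := Hl (c, Y); first by left.
have := RootZ c (root_span_sbr q1 q2 m1 m2); rewrite big_cons E -{}EY /=.
case: (p (+) q) => HY.
  by exists X0, (kscale c Y + X1); split=> //; [exact: RootD|zmod].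
by exists (kscale c Y + X0), X1; split=> //; [exact: RootD|zmod].
Qed.

(** Membership in sq_n(R) gives an even and an odd summand, each spanned by generators. The summand
    of the wrong parity is a difference of elements of the right one, hence homogeneous of both
    parities, hence zero. *)
Lemma gh_root_span p X : gh p X -> root_span p X.
Proof.
move=> [sX hX]; have [X0 [X1 [h0 h1 E]]] := in_sq_root_span sX.
have [_ m0] := root_span_gh h0; have [_ m1] := root_span_gh h1.
case: p hX => hX.
  have Z : X0 = 0.
    apply: mxh_direct => //; rewrite (_ : X0 = X + - X1); last by rewrite E; zmod.
    by apply: mxhD => //; exact: mxhN.
  by rewrite E Z add0r.
have Z : X1 = 0.
  apply: mxh_direct => //; rewrite (_ : X1 = X + - X0); last by rewrite E; zmod.
  by apply: mxhD => //; exact: mxhN.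
by rewrite E Z addr0.
Qed.

Lemma sbr_anti p q (X Y : M) : sbr p q X Y = - sg (p && q) (sbr q p Y X).
Proof. by rewrite !sbrE andbC; case: (_ && _); rewrite /sg; zmod. Qed.

Lemma mulmx_kscalel c (X Y : M) : kscale c X *m Y = kscale c (X *m Y).
Proof.
apply/matrixP => i j; rewrite !mxE scaler_sumr; apply: eq_bigr => l _.
by rewrite mxE scalerAl.
Qed.

Lemma mulmx_kscaler c (X Y : M) : X *m kscale c Y = kscale c (X *m Y).
Proof.
apply/matrixP => i j; rewrite !mxE scaler_sumr; apply: eq_bigr => l _.
by rewrite mxE scalerAr.
Qed.

Lemma kscaleN c (X : M) : kscale c (- X) = - kscale c X.
Proof. by apply/matrixP => i j; rewrite !mxE scalerN. Qed.

Lemma sbr_kscalel c p q (X Y : M) : sbr p q (kscale c X) Y = kscale c (sbr p q X Y).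
Proof.
rewrite !sbrE mulmx_kscalel mulmx_kscaler kscaleD kscaleN.
by case: (_ && _); rewrite /sg ?kscaleN.
Qed.

Lemma sbr_jacobi p q r (X Y Z : M) : sbr (p (+) q) r (sbr p q X Y) Z =
  sg (q && r) (sbr (p (+) r) q (sbr p r X Z) Y)
  - sg (p && (q (+) r)) (sbr (q (+) r) p (sbr q r Y Z) X).
Proof.
rewrite !sbrE; case: p q r => [] [] []; rewrite /sg /= ?opprK;
  rewrite !(mulmxDl, mulmxDr, mulmxN, mulNmx) !mulmxA; zmod.
Qed.

(** A bracket of opposite root vectors is diagonal, so its adjoint action preserves the position (l,
    m) and changes only the coefficient. *)
Lemma ebr_root i j s t l m u : i != j -> hvalid s -> hvalid t -> hvalid u ->
  exists v, [/\ hvalid v, hpar v = hpar s (+) hpar t (+) hpar u &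
    sbr (hpar s (+) hpar t) (hpar u) (ebr i j s j i t) (eh l m u) = eh l m v].
Proof.
move=> ij hs ht hu; rewrite eh_br // !eqxx.
have hst := hvalidM Rg hs ht; have hts := hvalidM Rg ht hs.
pose P := s.1.2 (+) t.1.2 (+) u.1.2.
pose B := s.1.1 (+) t.1.1 (+) u.1.1.
pose e := hpar s && hpar t.
pose e' := (hpar s (+) hpar t) && hpar u.
(* The diagonal element is e_ii(st) minus or plus e_jj(ts). It multiplies u from the left when l is
   i or j, and from the right when m is i or j. *)
pose v := (if i == l then (hmul (hmul s t) u).2 else 0)
  - sg e (if j == l then (hmul (hmul t s) u).2 else 0)
  - sg e' ((if m == i then (hmul u (hmul s t)).2 else 0)
          - sg e (if m == j then (hmul u (hmul t s)).2 else 0)).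
exists (B, P, v); split.
- have V w : hvalid w -> w.1.2 = P -> Rp P w.2 by rewrite /hvalid => ? <-.
  have Vif (c : bool) w : Rp P w -> Rp P (if c then w else 0).
    by case: c => // _; exact: sg_0.
  have [v1 v2 v3 v4] : [/\ Rp P (hmul (hmul s t) u).2,
      Rp P (hmul (hmul t s) u).2, Rp P (hmul u (hmul s t)).2 &
      Rp P (hmul u (hmul t s)).2].
    by split; apply: V; try (by do ?[apply: (hvalidM Rg) => //]);
      rewrite /= /P; case: s.1.2 t.1.2 u.1.2 => [] [] [].
  apply: (homogB Rg); last apply: (homog_sg Rg);
    apply: (homogB Rg); try apply: (homog_sg Rg); exact: Vif.
- by rewrite /hpar /= /B /P; case: s.1.1 t.1.1 u.1.1 s.1.2 t.1.2 u.1.2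
    => [] [] [] [] [] [].
rewrite sbrE mulmxBl mulmxBr.
have sgMl (b : bool) (X Y : M) : sg b X *m Y = sg b (X *m Y).
  by case: b; rewrite /sg ?mulNmx.
have sgMr (b : bool) (X Y : M) : X *m sg b Y = sg b (X *m Y).
  by case: b; rewrite /sg ?mulmxN.
rewrite sgMl sgMr !eh_mul // /eh /= /v.
have eif (c : bool) w : emx pi l m B (if c then w else 0) =
    if c then emx pi l m B w else 0.
  by case: c => //; exact: (emx0 Rg piP).
rewrite !(emxD piP, emxN Rg piP, emx_sg Rg piP) !eif.
rewrite -/e -/e' /B [t.1.1 (+) s.1.1]addbC [u.1.1 (+) _]addbC.
by congr (_ - sg _ _ - sg _ (_ - sg _ _)); case: eqP => // ->;
  rewrite -(emx_sg Rg piP) /hmul /= ?[t.1.1 (+) s.1.1]addbC.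
Qed.

(** * Vanishing of normalised cocycles *)

Section Vanishing.
Variables (W : lmodType k) (g : bool -> M -> bool -> M -> W).
Hypothesis gc : scocycle Rp g.
Hypothesis g_torus : forall i j s, i != j -> hvalid s ->
  g false (eh i i (hone R)) (hpar s) (eh i j s) = 0.
Hypothesis g_opp : forall i j s t, i != j -> hvalid s -> hvalid t ->
  g (hpar s) (eh i j s) (hpar t) (eh j i t) = 0.

Local Notation H i := (eh i i (hone R)).
Let ghH i : gh false (H i). Proof. exact: (gh_eh1 Rg piP halfP). Qed.
Let ghE i j s : i != j -> hvalid s -> gh (hpar s) (eh i j s).
Proof. exact: (gh_eh Rg piP). Qed.

Lemma torus_root i j s : i != j -> hvalid s ->
  sbr false (hpar s) (H i) (eh i j s) = eh i j s.
Proof.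
move=> ij hs; rewrite (@eh_br _ i i (hone R)) //; last exact: hvalid1.
by rewrite eqxx [j == i]eq_sym (negPf ij) hmul1s /= subr0.
Qed.

(* The weights of the two arguments under e_ii(1) add up to 1 or 2, a unit. *)
Lemma coc_root_neq i j s l m t : i != j -> l != m -> m != i ->
  hvalid s -> hvalid t -> g (hpar s) (eh i j s) (hpar t) (eh l m t) = 0.
Proof.
move=> ij lm mi hs ht; have h1 := hvalid1 Rg.
have := coc_ad Rg gc (ghH i) (ghE ij hs) (ghE lm ht).
rewrite torus_root // eh_br // (negPf mi) sg0 subr0.
rewrite (@eh_br _ i i (hone R)) // (negPf mi) sg0 subr0 hmul1s.
have -> : g false (H i) (hpar s (+) hpar t)
    (if j == l then eh i m (hmul s t) else 0) = 0.
  case: eqP => _; last exact: (coc_0r Rg gc).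
  by rewrite -hparM g_torus //; [rewrite eq_sym|exact: (hvalidM Rg)].
(* For l = i both arguments have weight 1 under e_ii(1), and twice the value vanishes; otherwise
   only the first has nonzero weight. *)
case: eqP => [->|_]; last by rewrite (coc_0r Rg gc _ (ghE ij hs)) addr0.
by move=> E; apply: (half_eq halfP); rewrite E addr0.
Qed.

Lemma coc_root i j s l m t : i != j -> l != m ->
  hvalid s -> hvalid t -> g (hpar s) (eh i j s) (hpar t) (eh l m t) = 0.
Proof.
move=> ij lm hs ht; have [mi|mi] := eqVneq m i; last exact: coc_root_neq.
subst m; have [jl|jl] := eqVneq j l; first by subst l; exact: g_opp.
(* After exchanging the arguments, the inequality required is j != l. *)
rewrite (coc_anti gc (ghE ij hs) (ghE lm ht)) coc_root_neq //.
by rewrite sg0 oppr0.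
Qed.

Lemma torus_diag l i j s t : i != j -> hvalid s -> hvalid t ->
  sbr false (hpar s (+) hpar t) (H l) (ebr i j s j i t) = 0.
Proof.
move=> ij hs ht; have h1 := hvalid1 Rg.
have hst := hvalidM Rg hs ht; have hts := hvalidM Rg ht hs.
rewrite eh_br // !eqxx sbrE mulmxBl mulmxBr /=.
have sgMl (b : bool) (X Y : M) : sg b X *m Y = sg b (X *m Y).
  by case: b; rewrite /sg ?mulNmx.
have sgMr (b : bool) (X Y : M) : X *m sg b Y = sg b (X *m Y).
  by case: b; rewrite /sg ?mulmxN.
rewrite sgMl sgMr !eh_mul // !hmul1s !hmuls1 [i == l]eq_sym [j == l]eq_sym.
have E (x : 'I_n) w : (if l == x then eh l x w else 0) = if l == x then eh x l w else 0.
  by case: eqP => [->|].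
by rewrite !E subrr.
Qed.

(** Under e_ll(1) the diagonal element has weight 0 and e_lm(u) has weight 1. The value therefore
    equals that of g at e_ll(1) and a bracket of the form e_lm(v), which is zero by [g_torus]. *)
Lemma coc_diag_root i j s t l m u : i != j -> l != m ->
  hvalid s -> hvalid t -> hvalid u ->
  g (hpar s (+) hpar t) (ebr i j s j i t) (hpar u) (eh l m u) = 0.
Proof.
move=> ij lm hs ht hu.
have ji : j != i by rewrite eq_sym.
have gd := sq_homog_sbr Rg (ghE ij hs) (ghE ji ht).
have := coc_ad Rg gc (ghH l) gd (ghE lm hu).
rewrite torus_diag // torus_root // (coc_0l Rg gc) ?add0r => [->|]; last exact: ghE.
have [v [hv <- ->]] := ebr_root l m ij hs ht hu.
exact: g_torus.
Qed.

(** The cocycle identity moves the second diagonal element into brackets with e_lm(u) and e_ml(w).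
    These brackets stay in their root spaces, so both terms pair opposite root vectors. *)
Lemma coc_diag_diag i j s t l m u w : i != j -> l != m ->
  hvalid s -> hvalid t -> hvalid u -> hvalid w ->
  g (hpar u (+) hpar w) (ebr l m u m l w) (hpar s (+) hpar t) (ebr i j s j i t) = 0.
Proof.
move=> ij lm hs ht hu hw.
have ji : j != i by rewrite eq_sym.
have ml : m != l by rewrite eq_sym.
have gd := sq_homog_sbr Rg (ghE ij hs) (ghE ji ht).
rewrite (gc.2 _ _ _ _ _ _ (ghE lm hu) (ghE ml hw) gd).
rewrite [sbr (hpar u) (hpar s (+) _) _ _]sbr_anti.
rewrite [sbr (hpar w) (hpar s (+) _) _ _]sbr_anti.
have [v [hv Ev ->]] := ebr_root l m ij hs ht hu.
have [v' [hv' Ev' ->]] := ebr_root m l ij hs ht hw.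
rewrite ![hpar _ (+) (hpar s (+) _)]addbC -Ev -Ev'.
have gv := ghE lm hv; have gv' := ghE ml hv'.
rewrite !(coc_Nl gc) ?(coc_sgl gc) ?g_opp //; try exact: ghE.
  by rewrite !(oppr0, sg0, addr0).
all: by case: (_ && _) => //; exact: (ghN Rg).
Qed.

Lemma coc_gen p q X Y : root_gen p X -> root_gen q Y -> g p X q Y = 0.
Proof.
case=> [[i [j [s [ij hs <- ->]]]]|[i [j [s [t [ij hs ht <- ->]]]]]].
  case=> [[l [m [u [lm hu <- ->]]]]|[l [m [u [w [lm hu hw <- ->]]]]]].
    exact: coc_root.
  have ml : m != l by rewrite eq_sym.
  have gd := sq_homog_sbr Rg (ghE lm hu) (ghE ml hw).
  rewrite (coc_anti gc (ghE ij hs) gd) coc_diag_root //.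
  by rewrite sg0 oppr0.
case=> [[l [m [u [lm hu <- ->]]]]|[l [m [u [w [lm hu hw <- ->]]]]]].
  exact: coc_diag_root.
exact: coc_diag_diag.
Qed.

Lemma cocycle_rigid p q X Y : gh p X -> gh q Y -> g p X q Y = 0.
Proof.
move=> /gh_root_span HX /gh_root_span.
elim: HX => {X} [X gX||X X' hX IH hX' IH'|c X hX IH].
- elim=> {Y} [Y gY||Y Y' hY IH hY' IH'|c Y hY IH].
  + exact: coc_gen.
  + by apply: (coc_0r Rg gc); exact: root_gen_gh.
  + rewrite (sbil_D2 gc.1) ?IH ?IH' ?addr0 //; try exact: root_span_gh.
    exact: root_gen_gh.
  + rewrite (sbil_Z2 gc.1) ?IH ?scaler0 //; try exact: root_span_gh.
    exact: root_gen_gh.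
- by move=> hY; apply: (coc_0l Rg gc); exact: root_span_gh.
- move=> hY; rewrite (sbil_D1 gc.1) ?IH ?IH' ?addr0 //; exact: root_span_gh.
- move=> hY; rewrite (sbil_Z1 gc.1) ?IH ?scaler0 //; exact: root_span_gh.
Qed.
End Vanishing.
End Rigidity.

(** * The trace form *)

Section TraceForm.
Variables (k : comNzRingType) (R : algType k) (Rp : bool -> R -> Prop).
Hypothesis Rg : supergrading Rp.
Variables (n : nat) (W : lmodType k).
Local Notation M := 'M[R]_(n + n).
Local Notation mxh := (mx_homog Rp (n := n)).
Local Notation kscale := (@kscale k R n).
Variable lam : bool -> R -> bool -> R -> W.

Definition scyclic := forall p q r a b c, Rp p a -> Rp q b -> Rp r c ->
  sg (p && r) (lam (p (+) q) (a * b) r c)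
  + sg (q && p) (lam (q (+) r) (b * c) p a)
  + sg (r && q) (lam (r (+) p) (c * a) q b) = 0.

Hypothesis lamb : sbilinear (fun a b : R => a + b) (fun c (a : R) => c *: a) Rp lam.

Definition trace_form p (X : M) q (Y : M) : W := \sum_i \sum_j
  (sg q (lam (~~ p) (co true X i j) q (co false Y j i))
   + lam p (co false X i j) (~~ q) (co true Y j i)).
Local Notation tr := trace_form.

Lemma lamDl p q a a' b : Rp p a -> Rp p a' -> Rp q b ->
  lam p (a + a') q b = lam p a q b + lam p a' q b.
Proof. exact: (sbil_D1 lamb). Qed.

Lemma lamZl c p q a b : Rp p a -> Rp q b -> lam p (c *: a) q b = c *: lam p a q b.
Proof. exact: (sbil_Z1 lamb). Qed.

Lemma lamZr c p q a b : Rp p a -> Rp q b -> lam p a q (c *: b) = c *: lam p a q b.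
Proof. exact: (sbil_Z2 lamb). Qed.

Lemma lam0l p q b : Rp q b -> lam p 0 q b = 0.
Proof.
by move=> Hb; have := lamZl 0 (sg_0 Rg p) Hb; rewrite !scale0r.
Qed.

Lemma lam0r p q a : Rp p a -> lam p a q 0 = 0.
Proof.
by move=> Ha; have := lamZr 0 Ha (sg_0 Rg q); rewrite !scale0r.
Qed.

Lemma lamNl p q a b : Rp p a -> Rp q b -> lam p (- a) q b = - lam p a q b.
Proof. by move=> Ha Hb; have := lamZl (-1) Ha Hb; rewrite !scaleN1r. Qed.

Lemma lam_sgl e p q a b : Rp p a -> Rp q b -> lam p (sg e a) q b = sg e (lam p a q b).
Proof. by case: e => //; exact: lamNl. Qed.

Lemma lam_suml (I : Type) (r : seq I) (F : I -> R) p q b :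
  (forall i, Rp p (F i)) -> Rp q b ->
  lam p (\sum_(i <- r) F i) q b = \sum_(i <- r) lam p (F i) q b.
Proof.
move=> HF Hb; elim: r => [|i r IH]; first by rewrite !big_nil lam0l.
by rewrite !big_cons lamDl ?IH //; exact: homog_sum.
Qed.

Lemma co0_homog p X i j : mxh p X -> Rp p (co false X i j).
Proof. by move=> /(mxh_co false i j); rewrite addbF. Qed.
Lemma co1_homog p X i j : mxh p X -> Rp (~~ p) (co true X i j).
Proof. by move=> /(mxh_co true i j); rewrite addbT. Qed.

Lemma trace_formDl p q X X' Y : mxh p X -> mxh p X' -> mxh q Y ->
  tr p (X + X') q Y = tr p X q Y + tr p X' q Y.
Proof.
move=> hX hX' hY; rewrite /tr -big_split; apply: eq_bigr => i _.
rewrite -big_split; apply: eq_bigr => j _ /=; rewrite !coD.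
rewrite !lamDl; try by [exact: co0_homog|exact: co1_homog].
by case: q {hY}; rewrite /sg; zmod.
Qed.

Lemma trace_form_anti p q X Y : mxh p X -> mxh q Y ->
  tr p X q Y = - sg (p && q) (tr q Y p X).
Proof.
move=> hX hY; rewrite /tr [X in _ = - sg _ X]exchange_big.
rewrite [X in _ = - X](_ : _ = \sum_i \sum_j sg (p && q)
  (sg p (lam (~~ q) (co true Y j i) p (co false X i j))
   + lam q (co false Y j i) (~~ p) (co true X i j))).
  rewrite -sumrN; apply: eq_bigr => i _; rewrite -sumrN; apply: eq_bigr => j _.
  have H1 := sbil_anti lamb (co1_homog i j hX) (co0_homog j i hY).
  have H2 := sbil_anti lamb (co0_homog i j hX) (co1_homog j i hY).
  rewrite {}H1 {}H2; case: p q {hX hY} => [] []; rewrite /sg /=; zmod.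
case: (p && q) => //; rewrite /sg -sumrN; apply: eq_bigr => i _.
by rewrite -sumrN.
Qed.

Lemma trace_formZl c p q X Y : mxh p X -> mxh q Y ->
  tr p (kscale c X) q Y = c *: tr p X q Y.
Proof.
move=> hX hY; rewrite /tr scaler_sumr; apply: eq_bigr => i _.
rewrite scaler_sumr; apply: eq_bigr => j _; rewrite !coZ.
rewrite !lamZl; try by [exact: co0_homog|exact: co1_homog].
by rewrite scalerDr; case: q {hY}; rewrite /sg ?scalerN.
Qed.

Lemma trace_form_bilin :
  sbilinear (fun X Y : M => X + Y) kscale (sq_homog Rp (n := n)) tr.
Proof.
split.
- by move=> p q X X' Y [_ hX] [_ hX'] [_ hY]; exact: trace_formDl.
- move=> p q X Y Y' [_ hX] [_ hY] [_ hY'].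
  rewrite !(trace_form_anti hX) // ?trace_formDl //; last exact: (mxhD Rg).
  by case: (_ && _); rewrite /sg; zmod.
- by move=> c p q X Y [_ hX] [_ hY]; exact: trace_formZl.
- move=> c p q X Y [_ hX] [_ hY].
  rewrite !(trace_form_anti hX) // ?trace_formZl //; last exact: (mxhZ Rg).
  by case: (_ && _); rewrite /sg ?scalerN.
- by move=> p q X Y [_ hX] [_ hY]; exact: trace_form_anti.
Qed.

Hypothesis lamc : scyclic.
Variable pi : bool -> R -> R.
Hypothesis piP : homog_projector Rp pi.

(** One summand of the trace form of XY and Z, for entries x0 + x1 nu, y0 + y1 nu and z0 + z1 nu of
    matrices of parities p, q, r. The first two terms come from the nu-part of the product of the
    first two entries, the others from the rest. *)
Definition trace3 p q r (x0 x1 y0 y1 z0 z1 : R) : W :=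
  sg r (lam (~~ (p (+) q)) (x0 * y1) r z0)
  + sg r (sg q (lam (~~ (p (+) q)) (x1 * y0) r z0))
  + lam (p (+) q) (x0 * y0) (~~ r) z1
  + sg (~~ q) (lam (p (+) q) (x1 * y1) (~~ r) z1).

(** Four cyclic relations add up to the claim, one for each choice of coefficients with an odd
    number of factors nu. *)
Lemma trace3_cyc p q r x0 x1 y0 y1 z0 z1 :
  Rp p x0 -> Rp (~~ p) x1 -> Rp q y0 -> Rp (~~ q) y1 -> Rp r z0 -> Rp (~~ r) z1 ->
  sg (p && r) (trace3 p q r x0 x1 y0 y1 z0 z1)
  + sg (q && p) (trace3 q r p y0 y1 z0 z1 x0 x1)
  + sg (r && q) (trace3 r p q z0 z1 x0 x1 y0 y1) = 0.
Proof.
move=> Hx0 Hx1 Hy0 Hy1 Hz0 Hz1.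
have H1 := lamc Hx0 Hy1 Hz0; have H2 := lamc Hx1 Hy0 Hz0.
have H3 := lamc Hx0 Hy0 Hz1; have H4 := lamc Hx1 Hy1 Hz1.
move: H1 H2 H3 H4; rewrite /trace3 /sg.
case: p q r {Hx0 Hx1 Hy0 Hy1 Hz0 Hz1} => [] [] [] /= H1 H2 H3 H4;
  zsigns H1 ltac:(fun a => zsigns H2 ltac:(fun b => zsigns H3 ltac:(fun c =>
    zsigns H4 ltac:(fun d =>
    apply: (eq_lincomb (eqD2 (eqD2 a b) (eqD2 c d))); zmod)))).
Qed.

Lemma trace_formM p q r X Y Z : in_q Rp Y -> mxh p X -> mxh q Y -> mxh r Z ->
  tr (p (+) q) (X *m Y) r Z = \sum_i \sum_j \sum_l
    trace3 p q r (co false X i l) (co true X i l) (co false Y l j) (co true Y l j)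
      (co false Z j i) (co true Z j i).
Proof.
move=> qY hX hY hZ; rewrite /tr; apply: eq_bigr => i _; apply: eq_bigr => j _.
rewrite !(coM piP _ _ _ _ qY) /=.
have X0 l := co0_homog i l hX; have X1 l := co1_homog i l hX.
have Y0 l := co0_homog l j hY; have Y1 l := co1_homog l j hY.
have Z0 := co0_homog j i hZ; have Z1 := co1_homog j i hZ.
have P00 l : Rp (p (+) q) (co false X i l * co false Y l j).
  exact: (sg_mul Rg (X0 l) (Y0 l)).
have P11 l : Rp (p (+) q) (co true X i l * co true Y l j).
  by have := sg_mul Rg (X1 l) (Y1 l); rewrite addNb addbN negbK.
have P01 l : Rp (~~ (p (+) q)) (co false X i l * co true Y l j).
  by have := sg_mul Rg (X0 l) (Y1 l); rewrite addbN.
have P10 l : Rp (~~ (p (+) q)) (co true X i l * co false Y l j).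
  by have := sg_mul Rg (X1 l) (Y0 l); rewrite addNb.
have E1 l : co true X i l * rho pi (co false Y l j) =
            sg q (co true X i l * co false Y l j).
  by rewrite (rho_homog piP (Y0 l)); case: (q); rewrite /sg ?mulrN.
have E2 l : co true X i l * rho pi (co true Y l j) =
            sg (~~ q) (co true X i l * co true Y l j).
  by rewrite (rho_homog piP (Y1 l)); case: (~~ q); rewrite /sg ?mulrN.
rewrite !lam_suml //; first last.
- by move=> l; rewrite E1; apply: sg_add => //; exact: homog_sg.
- by move=> l; rewrite E2; apply: sg_add => //; exact: homog_sg.
have -> (F : 'I_n -> W) : sg r (\sum_l F l) = \sum_l sg r (F l).
  by case: r {hZ Z0 Z1}; rewrite /sg // sumrN.
rewrite -big_split; apply: eq_bigr => l _ /=; rewrite E1 E2 /trace3.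
rewrite !lamDl //; try exact: (homog_sg Rg).
rewrite !lam_sgl //.
by case: (r); rewrite /sg; case: (q); zmod.
Qed.

Lemma trace_formM_cyc p q r X Y Z : in_q Rp X -> in_q Rp Y -> in_q Rp Z ->
  mxh p X -> mxh q Y -> mxh r Z ->
  sg (p && r) (tr (p (+) q) (X *m Y) r Z)
  + sg (q && p) (tr (q (+) r) (Y *m Z) p X)
  + sg (r && q) (tr (r (+) p) (Z *m X) q Y) = 0.
Proof.
move=> qX qY qZ hX hY hZ.
rewrite (trace_formM qY hX hY hZ) (trace_formM qZ hY hZ hX) (trace_formM qX hZ hX hY).
have sgS e (F : 'I_n -> 'I_n -> 'I_n -> W) :
    sg e (\sum_i \sum_j \sum_l F i j l) = \sum_i \sum_j \sum_l sg e (F i j l).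
  case: e => //; rewrite /sg -sumrN; apply: eq_bigr => i _; rewrite -sumrN.
  by apply: eq_bigr => j _; rewrite -sumrN.
rewrite !sgS.
(* All three sums are to be read at the entries X_il, Y_lj, Z_ji, so the two shifted ones need their
   summations reordered. *)
rewrite [X in _ + X + _](_ : _ = \sum_i \sum_j \sum_l sg (q && p)
   (trace3 q r p (co false Y l j) (co true Y l j) (co false Z j i) (co true Z j i)
     (co false X i l) (co true X i l))); last first.
  rewrite exchange_big; apply: eq_bigr => i _; rewrite exchange_big.
  by apply: eq_bigr => j _.
rewrite [X in _ + X](_ : _ = \sum_i \sum_j \sum_l sg (r && q)
   (trace3 r p q (co false Z j i) (co true Z j i) (co false X i l) (co true X i l)
     (co false Y l j) (co true Y l j))); last first.
  rewrite [RHS]exchange_big; apply: eq_bigr => j _; rewrite [RHS]exchange_big.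
  by apply: eq_bigr => l _.
rewrite -!big_split big1 // => i _; rewrite -!big_split big1 // => j _.
rewrite -!big_split big1 // => l _ /=.
by apply: trace3_cyc; by [exact: co0_homog|exact: co1_homog].
Qed.

Lemma trace_form_sbr p q r X Y Z : mxh p X -> mxh q Y -> mxh r Z ->
  tr (p (+) q) (sbr p q X Y) r Z =
  tr (p (+) q) (X *m Y) r Z - sg (p && q) (tr (q (+) p) (Y *m X) r Z).
Proof.
move=> hX hY hZ; have hXY := mxhM Rg hX hY; have hYX := mxhM Rg hY hX.
rewrite sbrE [q (+) p]addbC in hYX *.
have trN U : mxh (p (+) q) U -> tr (p (+) q) (- U) r Z = - tr (p (+) q) U r Z.
  by move=> hU; rewrite -kscaleN1 trace_formZl // scaleN1r.
rewrite trace_formDl //; last first.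
  by apply: (mxhN Rg); case: (p && q) => //; exact: (mxhN Rg).
rewrite trN; last by case: (p && q) => //; exact: (mxhN Rg).
by case: (p && q); rewrite /sg ?trN.
Qed.

Lemma trace_form_cocycle : scocycle Rp tr.
Proof.
split; first exact: trace_form_bilin.
move=> p q r X Y Z [sX hX] [sY hY] [sZ hZ].
have [qX qY qZ] := And3 (in_sq_q Rg piP sX) (in_sq_q Rg piP sY) (in_sq_q Rg piP sZ).
rewrite !trace_form_sbr //.
(* Expanding the brackets gives six terms; the cyclic orders XYZ and YXZ cover three each. *)
have H1 := trace_formM_cyc qX qY qZ hX hY hZ.
have H2 := trace_formM_cyc qY qX qZ hY hX hZ.
move: H1 H2; rewrite /sg.
case: p q r {hX hY hZ} => [] [] [] /= H1 H2;
  zsigns H1 ltac:(fun a => zsigns H2 ltac:(fun b =>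
    apply: (eq_lincomb (eqD2 a b)); zmod)).
Qed.
End TraceForm.

(** * The comparison map *)

Section Support.
Variables (k : comNzRingType) (K : choiceType) (Q : K -> Prop).
Local Notation F := {malg k[K]}.
(** [valid2] and [homog2] both have this form, so the closure properties below serve for either. *)
Definition supp_in (v : F) := forall t, t \in msupp v -> Q t.

Lemma supp_in0 : supp_in 0. Proof. by move=> t; rewrite msupp0. Qed.
Lemma supp_inD u v : supp_in u -> supp_in v -> supp_in (u + v).
Proof.
by move=> Hu Hv t /(fsubsetP (msuppD_le u v)); rewrite inE => /orP[/Hu|/Hv].
Qed.
Lemma supp_inZ c v : supp_in v -> supp_in (c *: v).
Proof. by move=> Hv t /(fsubsetP (msuppZ_le c v)) /Hv. Qed.
Lemma supp_inN v : supp_in v -> supp_in (- v).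
Proof. by rewrite -scaleN1r; exact: supp_inZ. Qed.
Lemma supp_in_sum (I : eqType) (r : seq I) (G : I -> F) :
  (forall i, i \in r -> supp_in (G i)) -> supp_in (\sum_(i <- r) G i).
Proof.
by rewrite big_seq => H; apply: big_ind => //; [exact: supp_in0|exact: supp_inD].
Qed.
Lemma supp_inU t : Q t -> supp_in << t >>.
Proof. by move=> Ht u; rewrite msuppU oner_eq0 in_fset1 => /eqP ->. Qed.
End Support.

Lemma supp_in_mext (k : comNzRingType) (K K' : choiceType) (Q : K -> Prop)
    (g : K' -> {malg k[K]}) (v : {malg k[K']}) :
  (forall t, t \in msupp v -> supp_in Q (g t)) -> supp_in Q (mext g v).
Proof. by move=> H; apply: supp_in_sum => t /H; exact: supp_inZ. Qed.

Section Comparison.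
Variables (k : comNzRingType) (R : algType k) (Rp : bool -> R -> Prop).
Hypothesis Rg : supergrading Rp.
Variable pi : bool -> R -> R.
Hypothesis piP : homog_projector Rp pi.
Variable n : nat.
Local Notation M := 'M[R]_(n + n).
Local Notation mxh := (mx_homog Rp (n := n)).
Local Notation gh := (sq_homog Rp (n := n)).
Local Notation hvalid := (hvalid Rp).
Local Notation eh := (@eh k R pi n).
Local Notation FM := {malg k[((bool * M) * (bool * M))%type]}.
Local Notation FR := {malg k[((bool * R) * (bool * R))%type]}.

(** The trace form with values in the free module itself. A linear map out of this module sends it
    to the trace form of the function that the map induces on pairs. *)
Definition trace_gen p (X : M) q (Y : M) : FR := \sum_i \sum_j
  (sgn k q *: e2 k (~~ p) (co true X i j) q (co false Y j i)
   + e2 k p (co false X i j) (~~ q) (co true Y j i)).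

Lemma lin_trace_gen (W : lmodType k) (phi : {linear FR -> W}) p X q Y :
  phi (trace_gen p X q Y) = trace_form (fun p a q b => phi (e2 k p a q b)) p X q Y.
Proof.
rewrite linear_sum; apply: eq_bigr => i _; rewrite linear_sum.
by apply: eq_bigr => j _; rewrite linearD linearZ /= sgnZ.
Qed.

Definition trace_map : FM -> FR := mext (unc2 trace_gen).

Lemma lin_trace_map (W : lmodType k) (phi : {linear FR -> W}) v :
  phi (trace_map v) =
  mext (unc2 (trace_form (fun p a q b => phi (e2 k p a q b)))) v.
Proof.
by rewrite /trace_map lin_mext_mext; apply: eq_mext_in => t _; exact: lin_trace_gen.
Qed.

Lemma trace_gen_supp (Q : (bool * R) * (bool * R) -> Prop) p X q Y :
  (forall i j, Q ((~~ p, co true X i j), (q, co false Y j i))) ->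
  (forall i j, Q ((p, co false X i j), (~~ q, co true Y j i))) ->
  supp_in Q (trace_gen p X q Y).
Proof.
move=> H1 H2; apply: supp_in_sum => i _; apply: supp_in_sum => j _.
by apply: supp_inD; [apply: supp_inZ|]; apply: supp_inU.
Qed.

Lemma trace_map_valid v : valid2 gh v -> valid2 Rp (trace_map v).
Proof.
move=> Hv; apply: supp_in_mext => t /Hv [[_ hX] [_ hY]].
apply: trace_gen_supp => i j; split => /=;
  by [exact: co0_homog hX|exact: co0_homog hY|exact: co1_homog hX|exact: co1_homog hY].
Qed.

Lemma trace_map_homog s v : homog2 s v -> homog2 (s (+) true) (trace_map v).
Proof.
move=> Hv; apply: supp_in_mext => t /Hv <-; rewrite addbT.
by apply: trace_gen_supp => i j /=; rewrite ?addNb ?addbN.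
Qed.

Lemma d2E (v : FM) r s : d2 v r s = mext (unc2 (fun p X q Y => sbr p q X Y r s)) v.
Proof. by rewrite /d2 summxE; apply: eq_bigr => t _; rewrite mxE. Qed.

Definition scomm2 p (a : R) q (b : R) : R := scomm p q a b.

Lemma scommE p q (a b : R) : scomm p q a b = a * b - sg (p && q) (b * a).
Proof. by rewrite /scomm /sg; case: (_ && _); rewrite ?opprK. Qed.

(** Relates the two cycle conditions: applying the supercommutator to the trace form gives the queer
    trace of the bracket, that is, the sum of its diagonal nu-coefficients, and this vanishes when
    summed over a cycle. *)
Lemma trace_form_scomm p X q Y : in_q Rp X -> in_q Rp Y -> mxh p X -> mxh q Y ->
  trace_form scomm2 p X q Y = \sum_i co true (sbr p q X Y) i i.
Proof.
move=> qX qY hX hY; rewrite sbrE.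
have sgS e (F : 'I_n -> R) : \sum_i sg e (F i) = sg e (\sum_i F i).
  by case: e; rewrite /sg // sumrN.
rewrite (_ : \sum_i _ =
    \sum_i co true (X *m Y) i i - sg (p && q) (\sum_i co true (Y *m X) i i)); last first.
  rewrite -sgS -sumrN -big_split; apply: eq_bigr => i _.
  by rewrite coD coN; case: (_ && _); rewrite /sg ?coN.
under eq_bigr => i _ do rewrite (coM piP _ _ _ _ qY).
under [X in sg _ X]eq_bigr => i _ do rewrite (coM piP _ _ _ _ qX).
rewrite [X in sg _ X]exchange_big -sgS -sumrN -big_split; apply: eq_bigr => i _ /=.
rewrite -sgS -sumrN -big_split; apply: eq_bigr => j _ /=.
rewrite /scomm2 !scommE (rho_homog piP (co0_homog j i hY)).
rewrite (rho_homog piP (co0_homog i j hX)).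
by case: p q {hX hY} => [] []; rewrite /sg /= ?mulrN; zmod.
Qed.

Lemma trace_map_cycle v : Z2 Rp v -> ZHC Rp (trace_map v).
Proof.
move=> [vv dv]; split; first exact: trace_map_valid.
rewrite -[LHS]/(mext (unc2 scomm2) (trace_map v)).
rewrite (lin_trace_map (mext (unc2 scomm2))).
transitivity (mext (unc2 (fun p X q Y => \sum_i co true (sbr p q X Y : M) i i)) v).
  apply: eq_mext_in => t /vv [[sX hX] [sY hY]].
  rewrite /unc2 -trace_form_scomm //; try exact: (in_sq_q Rg piP).
  by apply: eq_bigr => i _; apply: eq_bigr => j _; rewrite /= !mext_e2.
transitivity (\sum_i co true (d2 v) i i); last first.
  by rewrite dv big1 // => i _; rewrite co0.
rewrite /mext; under eq_bigr => t _ do rewrite scaler_sumr.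
by rewrite exchange_big; apply: eq_bigr => i _; rewrite /co d2E.
Qed.

Section TraceRoot.
Variables (W : lmodType k) (lam : bool -> R -> bool -> R -> W).
Hypothesis lamb : sbilinear (fun a b : R => a + b) (fun c (a : R) => c *: a) Rp lam.

(** The value of the trace form on e_ij(s) and e_ji(t); only an odd total power of nu
    contributes. *)
Definition trace_root (s t : hel R) : W :=
  if s.1.1 == t.1.1 then 0 else sg (s.1.1 && t.1.2) (lam s.1.2 s.2 t.1.2 t.2).

Lemma trace_form_eh i j s l m t : hvalid s -> hvalid t ->
  trace_form lam (hpar s) (eh i j s) (hpar t) (eh l m t) =
  if (j == l) && (m == i) then trace_root s t else 0.
Proof.
move=> hs ht; have Z p := sg_0 Rg p.
have l0 p q b : Rp q b -> lam p 0 q b = 0 by exact: (lam0l Rg lamb).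
have r0 p q a : Rp p a -> lam p a q 0 = 0 by exact: (lam0r Rg lamb).
rewrite /trace_form; transitivity (\sum_i' \sum_j'
    (if [&& i' == i, j' == j, j' == l & i' == m] then trace_root s t else 0)).
  apply: eq_bigr => i' _; apply: eq_bigr => j' _.
  rewrite /eh !co_emx /trace_root /hpar.
  move: s t hs ht => [[b p] a] [[c q] d]; rewrite /hvalid /= => Ha Hd.
  case: (i' == i); case: (j' == j); case: (j' == l); case: (i' == m);
    case: b c => [] [] /=;
    rewrite ?negbK ?addFb ?addTb ?negbK ?l0 ?r0 ?sg0 ?addr0 ?add0r //.
case: eqP => [->|jl] /=; last first.
  rewrite big1 // => i' _; rewrite big1 // => j' _.
  by case: ifP => // /and4P[_ /eqP Ej /eqP El _]; case: jl; rewrite -Ej.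
case: eqP => [->|mi] /=; last first.
  rewrite big1 // => i' _; rewrite big1 // => j' _.
  by case: ifP => // /and4P[/eqP Ei _ _ /eqP Em]; case: mi; rewrite -Ei.
rewrite (bigD1 i) //= (bigD1 l) //= !eqxx /= !big1 ?addr0 // => [i' /negPf H|j' /negPf H].
  by rewrite big1 // => j' _; rewrite H.
by rewrite H.
Qed.
End TraceRoot.

(** With b = c = 1 the cyclic relation reads 2 lambda(a, 1) + lambda(1, a) = 0, and lambda(1, a) = -
    lambda(a, 1). *)
Lemma lam1r (W : lmodType k) (lam : bool -> R -> bool -> R -> W) p a :
  sbilinear (fun a b : R => a + b) (fun c (a : R) => c *: a) Rp lam ->
  scyclic Rp lam -> Rp p a -> lam p a false 1 = 0.
Proof.
move=> lamb lamc Ha; have H1 := sg_1 Rg.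
have := lamc _ _ _ _ _ _ Ha H1 H1; have := sbil_anti lamb H1 Ha.
rewrite !andbF !addbF /= !mulr1 !mul1r => -> E.
by apply: (eq_lincomb E); zmod.
Qed.

(** * Lifting cycles from R to matrices *)

Variables i0 i1 : 'I_n.
Hypothesis i01 : i0 != i1.

(** The trace forms of the two pairs are lambda(a, b) and lambda(ab, 1) = 0. The second pair cancels
    the diagonal entry of the boundary at [i0], leaving [a, b] nu at [i1], which vanishes when
    summed over a cycle. *)
Definition root_lift p (a : R) q (b : R) : FM :=
  e2 k p (eh i0 i1 (false, p, a)) (~~ q) (eh i1 i0 (true, q, b))
  - e2 k (p (+) q) (eh i0 i1 (false, p (+) q, a * b)) true (eh i1 i0 (hnu R)).

Lemma root_lift_sbr p a q b : Rp p a -> Rp q b ->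
  sbr p (~~ q) (eh i0 i1 (false, p, a)) (eh i1 i0 (true, q, b))
  - sbr (p (+) q) true (eh i0 i1 (false, p (+) q, a * b)) (eh i1 i0 (hnu R)) =
  emx pi i1 i1 true (scomm2 p a q b).
Proof.
move=> Ha Hb; have Hab := sg_mul Rg Ha Hb; have Hn := hvalid_nu Rg.
rewrite (eh_br Rg piP i0 i1 i1 i0 (s := (false, p, a)) (t := (true, q, b))) //.
rewrite (eh_br Rg piP i0 i1 i1 i0 (s := (false, p (+) q, a * b)) (t := hnu R)) //.
rewrite !eqxx /hmul /eh /= mulr1 mul1r /scomm2 scommE.
rewrite !(emxD piP, emxN Rg piP, emx_sg Rg piP).
by case: p q {Ha Hb Hab} => [] []; rewrite /sg /=; zmod.
Qed.

Lemma root_lift_valid p a q b : Rp p a -> Rp q b -> valid2 gh (root_lift p a q b).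
Proof.
move=> Ha Hb; have Hab := sg_mul Rg Ha Hb; have Hn := hvalid_nu Rg.
have i10 : i1 != i0 by rewrite eq_sym.
apply: supp_inD; last apply: supp_inN; apply: supp_inU; split=> /=.
- exact: (gh_eh Rg piP (s := (false, p, a))).
- exact: (gh_eh Rg piP (s := (true, q, b))).
- exact: (gh_eh Rg piP (s := (false, p (+) q, a * b))).
- exact: (gh_eh Rg piP (s := hnu R)).
Qed.

Lemma root_lift_cycle w : ZHC Rp w -> Z2 Rp (mext (unc2 root_lift) w).
Proof.
move=> [vw cw]; split.
  by apply: supp_in_mext => t /vw [Ha Hb]; exact: root_lift_valid.
apply/matrixP => r s; rewrite d2E mxE lin_mext_mext.
transitivity (mext (unc2 (fun p a q b => emx pi i1 i1 true (scomm2 p a q b) r s)) w).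
  apply: eq_mext_in => -[[p a] [q b]] /vw [Ha Hb].
  rewrite [RHS]/unc2 -(root_lift_sbr Ha Hb) !mxE; exact: mext_e2B.
transitivity (emx pi i1 i1 true (mext (unc2 scomm2) w) r s); last first.
  by rewrite [mext _ _]cw (emx0 Rg piP) mxE.
rewrite /mext; elim: (enum_fset _) => [|t l IH].
  by rewrite !big_nil (emx0 Rg piP) mxE.
rewrite !big_cons IH (emxD piP) (emxZ Rg piP) [RHS]mxE; congr (_ + _).
by rewrite [RHS]mxE.
Qed.
End Comparison.

(** * Linear maps on <R, R> *)

Section CyclicKernel.
Variables (k : comNzRingType) (R : algType k) (Rp : bool -> R -> Prop).
Variable W : lmodType k.
Local Notation FR := {malg k[((bool * R) * (bool * R))%type]}.
Local Notation bilin := (sbilinear (fun a b : R => a + b) (fun c (a : R) => c *: a) Rp).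

Definition BHC_gen (w : FR) : Prop := bilin_rel +%R ( *:%R ) Rp w \/
  santisym_rel Rp w \/ cyc_rel Rp w.

Lemma lin_sum3 (V : lmodType k) (phi : {linear V -> W}) b c d x y z :
  phi (b *: x + c *: y + d *: z) = b *: phi x + c *: phi y + d *: phi z.
Proof. by rewrite !linearD !linearZ. Qed.

Lemma BHC_lin (phi : {linear FR -> W}) : (forall v, BHC Rp v -> phi v = 0) ->
  bilin (fun p a q b => phi (e2 k p a q b)) /\
  scyclic Rp (fun p a q b => phi (e2 k p a q b)).
Proof.
move=> H; split.
  by apply: sbilinear_lin => v Hv; apply: H; apply: kspan_gen; case: Hv; tauto.
move=> p q r a b c Ha Hb Hc; rewrite -!sgnZ -lin_sum3; apply: H.
by apply: kspan_gen; right; right; exists p, q, r, a, b, c.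
Qed.

Lemma BHC_mext (lam : bool -> R -> bool -> R -> W) : bilin lam -> scyclic Rp lam ->
  forall v, BHC Rp v -> mext (unc2 lam) v = 0.
Proof.
move=> lamb lamc; apply: (kspan_lin_eq0 (phi := mext (unc2 lam))) => v /=.
case=> [H|[H|]].
- by apply: (sbilinear_mext lamb); left.
- by apply: (sbilinear_mext lamb); right.
move=> [p [q [r [a [b [c [Ha Hb Hc ->]]]]]]].
by rewrite (lin_sum3 (mext (unc2 lam))) /= !mext_e2 !sgnZ lamc.
Qed.
End CyclicKernel.

(** * The induced isomorphism *)

Section Iso.
Variables (k : comNzRingType) (R : algType k) (Rp : bool -> R -> Prop).
Hypothesis Rg : supergrading Rp.
Variable pi : bool -> R -> R.
Hypothesis piP : homog_projector Rp pi.
Variable n : nat.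
Local Notation M := 'M[R]_(n + n).
Local Notation kscale := (@kscale k R n).
Local Notation mxh := (mx_homog Rp (n := n)).
Local Notation gh := (sq_homog Rp (n := n)).
Local Notation hvalid := (hvalid Rp).
Local Notation eh := (@eh k R pi n).
Local Notation FM := {malg k[((bool * M) * (bool * M))%type]}.

(** Followed by the universal map to the quotient by I_R, the trace map is the linear extension of a
    trace form, which is a cocycle and hence kills all boundaries. *)
Lemma trace_map_bound (v : FM) : B2 Rp v -> BHC Rp (trace_map v).
Proof.
move=> Bv.
have [W [phi Hphi]] := kspan_quot (BHC_gen Rp).
apply/Hphi; have [lamb lamc] := @BHC_lin k R Rp W phi (fun v => proj2 (Hphi v)).
rewrite lin_trace_map.
apply: (kspan_lin_eq0 (phi := mext (unc2 (trace_form _))) _ Bv) => u Hu /=.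
exact: (scocycle_mext (trace_form_cocycle Rg n lamb lamc piP) Hu).
Qed.

Lemma trace_map_surj (i0 i1 : 'I_n) w : i0 != i1 -> ZHC Rp w ->
  exists z : FM, Z2 Rp z /\ BHC Rp (trace_map z - w).
Proof.
move=> i01 Zw; exists (mext (unc2 (root_lift pi i0 i1)) w).
split; first exact: (root_lift_cycle Rg piP).
have [W [phi Hphi]] := kspan_quot (BHC_gen Rp).
apply/Hphi; have [lamb lamc] := @BHC_lin k R Rp W phi (fun v => proj2 (Hphi v)).
rewrite linearB /= lin_trace_map lin_mext_mext (lin_mext phi w) /=.
apply/eqP; rewrite subr_eq0; apply/eqP.
apply: eq_mext_in => -[[p a] [q b]] /(proj1 Zw) [/= Ha Hb].
rewrite [LHS]mext_e2B.
have Hab := sg_mul Rg Ha Hb; have Hn := hvalid_nu Rg.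
rewrite (trace_form_eh Rg pi lamb i0 i1 i1 i0
  (s := (false, p, a)) (t := (true, q, b))) //.
rewrite (trace_form_eh Rg pi lamb i0 i1 i1 i0
  (s := (false, p (+) q, a * b)) (t := hnu R)) //.
by rewrite !eqxx /trace_root /= (lam1r Rg lamb lamc Hab) subr0.
Qed.

(** * Injectivity of the trace map *)

Section Injectivity.
Variable half : k.
Hypothesis halfP : 2%:R * half = 1.
Hypothesis n3 : (3 <= n)%N.
Variables (W : lmodType k) (beta : bool -> M -> bool -> M -> W).
Hypothesis beta_coc : scocycle Rp beta.

Definition opp_pairing (i j : 'I_n) (s t : hel R) : W :=
  beta (hpar s) (eh i j s) (hpar t) (eh j i t).
Local Notation F := opp_pairing.

Let ghE i j s : i != j -> hvalid s -> gh (hpar s) (eh i j s).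
Proof. exact: (gh_eh Rg piP). Qed.

Lemma opp_pairing_anti i j s t : i != j -> hvalid s -> hvalid t ->
  F i j s t = - sg (hpar s && hpar t) (F j i t s).
Proof.
by move=> ij hs ht; apply: (coc_anti beta_coc); apply: ghE; rewrite // eq_sym.
Qed.

(** The cocycle identity on e_il(s), e_lj(t), e_ji(u), whose brackets are e_ij(st), e_li(tu) and, up
    to sign, e_jl(us). *)
Lemma opp_pairing_mul i j l s t u : i != j -> j != l -> i != l ->
  hvalid s -> hvalid t -> hvalid u ->
  F i j (hmul s t) u =
  F i l s (hmul t u) + sg (hpar s && (hpar t (+) hpar u)) (F l j t (hmul u s)).
Proof.
move=> ij jl il hs ht hu.
have [ji lj li] : [/\ j != i, l != j & l != i] by split; rewrite eq_sym.
have := beta_coc.2 _ _ _ _ _ _ (ghE il hs) (ghE lj ht) (ghE ji hu).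
rewrite !(eh_br Rg piP) // !eqxx (negPf ji) (negPf il) (negPf lj) !sg0 !subr0 sub0r.
rewrite -!hparM.
have hus := hvalidM Rg hu hs; have htu := hvalidM Rg ht hu.
have E : hpar (hmul s u) = hpar (hmul u s) by rewrite !hparM addbC.
have g1 : gh (hpar (hmul s u)) (eh j l (hmul u s)) by rewrite E; exact: ghE.
rewrite (coc_Nl beta_coc) ?(coc_sgl beta_coc) //; last 3 first.
- exact: ghE.
- by case: (_ && _) => //; exact: (ghN Rg).
- exact: ghE.
rewrite /F => ->; rewrite E.
rewrite (coc_anti beta_coc (ghE il hs) (ghE li htu)).
rewrite (coc_anti beta_coc (ghE lj ht) (ghE jl hus)) !hparM.
by case: (hpar s) (hpar t) (hpar u) => [] [] []; rewrite /sg /=; zmod.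
Qed.

Lemma opp_pairingD1 i j b p a a' t : i != j -> Rp p a -> Rp p a' -> hvalid t ->
  F i j (b, p, a + a') t = F i j (b, p, a) t + F i j (b, p, a') t.
Proof.
move=> ij Ha Ha' ht; have ji : j != i by rewrite eq_sym.
rewrite /F /eh /= (emxD piP).
exact: (sbil_D1 beta_coc.1 (ghE ij (s := (b, p, a)) Ha)
  (ghE ij (s := (b, p, a')) Ha') (ghE ji ht)).
Qed.

Lemma opp_pairingZ1 i j b p c a t : i != j -> Rp p a -> hvalid t ->
  F i j (b, p, c *: a) t = c *: F i j (b, p, a) t.
Proof.
move=> ij Ha ht; have ji : j != i by rewrite eq_sym.
rewrite /F /eh /= (emxZ Rg piP).
exact: (sbil_Z1 beta_coc.1 c (ghE ij (s := (b, p, a)) Ha) (ghE ji ht)).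
Qed.

Lemma opp_pairingD2 i j s b p a a' : i != j -> hvalid s -> Rp p a -> Rp p a' ->
  F i j s (b, p, a + a') = F i j s (b, p, a) + F i j s (b, p, a').
Proof.
move=> ij hs Ha Ha'; have ji : j != i by rewrite eq_sym.
rewrite /F /eh /= (emxD piP).
exact: (sbil_D2 beta_coc.1 (ghE ij hs) (ghE ji (s := (b, p, a)) Ha)
  (ghE ji (s := (b, p, a')) Ha')).
Qed.

Lemma opp_pairingZ2 i j s b p c a : i != j -> hvalid s -> Rp p a ->
  F i j s (b, p, c *: a) = c *: F i j s (b, p, a).
Proof.
move=> ij hs Ha; have ji : j != i by rewrite eq_sym.
rewrite /F /eh /= (emxZ Rg piP).
exact: (sbil_Z2 beta_coc.1 c (ghE ij hs) (ghE ji (s := (b, p, a)) Ha)).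
Qed.

Definition o0 : 'I_n := Ordinal (ltnW (ltnW n3)).
Definition o1 : 'I_n := Ordinal (ltnW n3).
Definition o2 : 'I_n := Ordinal n3.

(** Two indices cannot exhaust [o0], [o1] and [o2]; the last of these exists because n >= 3. *)
Lemma third_index (i j : 'I_n) : exists l : 'I_n, (i != l) && (j != l).
Proof.
have [i0|i0] := boolP ((i != o0) && (j != o0)); first by exists o0.
have [i1|i1] := boolP ((i != o1) && (j != o1)); first by exists o1.
exists o2; move: i0 i1; rewrite -!val_eqE /=.
by case: (val i) (val j) => [|[|[|?]]] [|[|[|?]]].
Qed.

Local Notation hvalid1 := (hvalid1 Rg).
Local Notation hvalidM := (hvalidM Rg).
Local Notation G := (pairing_core (@hmul k R) (hone R) F o0 o1).

Lemma core1s s : G (hone R) s = 0.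
Proof. by apply: pairing_core1s; exact: hmul1s. Qed.

Lemma coreM s t u : hvalid s -> hvalid t -> hvalid u ->
  G (hmul s t) u =
  G s (hmul t u) + sg (hpar s && (hpar t (+) hpar u)) (G t (hmul u s)).
Proof.
apply: (pairing_coreM (V := hvalid)) => //.
- exact: hmulA.
- exact: hmul1s.
- exact: hmuls1.
- exact: hparM.
- exact: hvalid1.
- exact: hvalidM.
- exact: opp_pairing_mul.
- exact: third_index.
Qed.

Lemma core_anti s t : hvalid s -> hvalid t -> G s t = - sg (hpar s && hpar t) (G t s).
Proof.
apply: (pairing_core_anti (V := hvalid)) => //.
- exact: hmulA.
- exact: hmul1s.
- exact: hmuls1.
- exact: hparM.
- exact: hvalid1.
- exact: hvalidM.
- exact: opp_pairing_anti.
- exact: opp_pairing_mul.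
- exact: third_index.
Qed.

Lemma opp_pairing_decomp i j s u : i != j -> hvalid s -> hvalid u ->
  F i j s u = pairing_diag (hone R) F o0 i (hmul s u)
    - sg (hpar s && hpar u) (pairing_diag (hone R) F o0 j (hmul u s)) + G s u.
Proof.
apply: (pairing_decomp (V := hvalid)) => //.
- exact: hmulA.
- exact: hmul1s.
- exact: hmuls1.
- exact: hparM.
- exact: hvalid1.
- exact: hvalidM.
- exact: opp_pairing_anti.
- exact: opp_pairing_mul.
- exact: third_index.
Qed.

Lemma coreD1 b p a a' t : Rp p a -> Rp p a' -> hvalid t ->
  G (b, p, a + a') t = G (b, p, a) t + G (b, p, a') t.
Proof.
move=> Ha Ha' ht; rewrite /pairing_core opp_pairingD1 //.
have -> : hmul (b, p, a + a') t = (b (+) t.1.1, p (+) t.1.2,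
    sg (b && t.1.2) (a * t.2) + sg (b && t.1.2) (a' * t.2)).
  by rewrite /hmul /= mulrDl; case: (_ && _); rewrite /sg ?opprD.
rewrite opp_pairingD2 //; first by rewrite /hmul /=; zmod.
- exact: hvalid1.
- exact: (hvalidM (s := (b, p, a))).
- exact: (hvalidM (s := (b, p, a'))).
Qed.

Lemma coreZ1 b p c a t : Rp p a -> hvalid t -> G (b, p, c *: a) t = c *: G (b, p, a) t.
Proof.
move=> Ha ht; rewrite /pairing_core opp_pairingZ1 //.
have -> : hmul (b, p, c *: a) t = (b (+) t.1.1, p (+) t.1.2,
    c *: sg (b && t.1.2) (a * t.2)).
  by rewrite /hmul /= -scalerAl; case: (_ && _); rewrite /sg ?scalerN.
rewrite opp_pairingZ2 // ?scalerBr //; first exact: hvalid1.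
exact: (hvalidM (s := (b, p, a))).
Qed.

Lemma coreD2 s b p a a' : hvalid s -> Rp p a -> Rp p a' ->
  G s (b, p, a + a') = G s (b, p, a) + G s (b, p, a').
Proof.
move=> hs Ha Ha'; have Haa : Rp p (a + a') by exact: (sg_add Rg).
have A x (Hx : Rp p x) := core_anti hs (t := (b, p, x)) Hx.
rewrite !A // coreD1 // /hpar /=.
by case: (_ && _); rewrite /sg; zmod.
Qed.

Lemma coreZ2 s b p c a : hvalid s -> Rp p a -> G s (b, p, c *: a) = c *: G s (b, p, a).
Proof.
move=> hs Ha; have Haa : Rp p (c *: a) by exact: (sg_scale Rg).
have A x (Hx : Rp p x) := core_anti hs (t := (b, p, x)) Hx.
rewrite !A // coreZ1 // /hpar /=.
by case: (_ && _); rewrite /sg !scalerN.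
Qed.

Lemma coreN1 b p a t : Rp p a -> hvalid t -> G (b, p, - a) t = - G (b, p, a) t.
Proof. by move=> Ha ht; rewrite -scaleN1r coreZ1 // scaleN1r. Qed.

Lemma coreN2 s b p a : hvalid s -> Rp p a -> G s (b, p, - a) = - G s (b, p, a).
Proof. by move=> hs Ha; rewrite -scaleN1r coreZ2 // scaleN1r. Qed.

Local Notation Gam := (core_odd G).

(** Together with [Gam_cyc] this makes Gamma a function on <R, R>, so that its trace form is a
    cocycle. *)
Lemma Gam_bilin : sbilinear (fun a b : R => a + b) (fun c (a : R) => c *: a) Rp Gam.
Proof.
split.
- by move=> p q a a' b Ha Ha' Hb; exact: coreD1.
- by move=> p q a b b' Ha Hb Hb'; exact: coreD2.
- by move=> c p q a b Ha Hb; exact: coreZ1.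
- by move=> c p q a b Ha Hb; exact: coreZ2.
- move=> p q a b Ha Hb.
  exact: (core_odd_anti Rg halfP coreN2 core1s coreM core_anti Ha Hb).
Qed.

Lemma Gam_cyc : scyclic Rp Gam.
Proof.
move=> p q r a b c Ha Hb Hc.
exact: (core_odd_cyc Rg halfP coreN2 core1s coreM core_anti Ha Hb Hc).
Qed.

(* Half of G(a nu, nu) accounts for the part of G that is even in nu, so that only
   its odd part [core_odd] remains in [opp_pairingE]. *)
Definition theta_diag i (s : hel R) : W := pairing_diag (hone R) F o0 i s
  + (if s.1.1 then 0 else core_diag half G s).

(** The product st is free of nu exactly when s and t carry the same power of nu. The correction in
    [theta_diag] thus enters only where [core_even] applies; elsewhere [core_oddE] leaves the trace
    term. *)
Lemma opp_pairingE i j s t : i != j -> hvalid s -> hvalid t ->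
  F i j s t = theta_diag i (hmul s t)
    - sg (hpar s && hpar t) (theta_diag j (hmul t s)) + trace_root Gam s t.
Proof.
move=> ij hs ht; rewrite opp_pairing_decomp // /theta_diag /trace_root.
have [E|E] := eqVneq s.1.1 t.1.1.
  rewrite (core_even Rg halfP coreN1 coreN2 coreM core_anti hs ht E) /= E addbb.
  by case: (_ && _); rewrite /sg; zmod.
rewrite (core_oddE Rg halfP coreN2 core1s coreM hs ht E) /=.
rewrite [t.1.1 (+) _]addbC (_ : s.1.1 (+) t.1.1 = true); last first.
  by move: E; case: s.1.1 t.1.1 => [] [].
by case: (hpar s && hpar t); rewrite /sg; zmod.
Qed.

(** * The cochain theta *)

Local Notation pdiag := (pairing_diag (hone R) F o0).

Lemma pdiagD i b p a a' : Rp p a -> Rp p a' ->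
  pdiag i (b, p, a + a') = pdiag i (b, p, a) + pdiag i (b, p, a').
Proof.
move=> Ha Ha'; rewrite /pairing_diag; case: eqP => [_|/eqP io].
  by rewrite addr0.
exact: (opp_pairingD2 b io hvalid1 Ha Ha').
Qed.

Lemma pdiagZ i b p c a : Rp p a -> pdiag i (b, p, c *: a) = c *: pdiag i (b, p, a).
Proof.
move=> Ha; rewrite /pairing_diag; case: eqP => [_|/eqP io].
  by rewrite scaler0.
exact: (opp_pairingZ2 b c io hvalid1 Ha).
Qed.

Lemma scale_add4 (d : k) (u v x y : W) :
  u + v + d *: (x + y) = (u + d *: x) + (v + d *: y).
Proof. by rewrite scalerDr; zmod. Qed.

Lemma scale_comm_add (d c : k) (u x : W) :
  c *: u + d *: (c *: x) = c *: (u + d *: x).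
Proof. by rewrite scalerDr !scalerA [d * c]mulrC. Qed.

Lemma theta_diagD i b p a a' : Rp p a -> Rp p a' ->
  theta_diag i (b, p, a + a') = theta_diag i (b, p, a) + theta_diag i (b, p, a').
Proof.
move=> Ha Ha'; rewrite /theta_diag /core_diag pdiagD //; case: b => /=.
  by rewrite !addr0.
by rewrite (coreD1 true Ha Ha' (hvalid_nu Rg)) scale_add4.
Qed.

Lemma theta_diagZ i b p c a : Rp p a ->
  theta_diag i (b, p, c *: a) = c *: theta_diag i (b, p, a).
Proof.
move=> Ha; rewrite /theta_diag /core_diag pdiagZ //; case: b => /=.
  by rewrite !addr0.
by rewrite (coreZ1 true c Ha (hvalid_nu Rg)) scale_comm_add.
Qed.

(** The off-diagonal values are dictated by e_ij(s) = [e_ii(1), e_ij(s)], since the coboundary of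
    theta has to agree with beta on this pair. *)
Definition theta_coef i j b p (a : R) : W :=
  if i == j then theta_diag i (b, p, a)
  else beta false (eh i i (hone R)) (b (+) p) (eh i j (b, p, a)).

Let ghH i : gh false (eh i i (hone R)).
Proof. exact: (gh_eh1 Rg piP halfP). Qed.

Lemma theta_coefD i j b p a a' : Rp p a -> Rp p a' ->
  theta_coef i j b p (a + a') = theta_coef i j b p a + theta_coef i j b p a'.
Proof.
move=> Ha Ha'; rewrite /theta_coef; case: eqP => [_|/eqP ij].
  exact: theta_diagD.
rewrite -[eh i j (b, p, a + a')]/(emx pi i j b (a + a')) (emxD piP).
exact: (sbil_D2 beta_coc.1 (ghH i) (ghE ij (s := (b, p, a)) Ha)
  (ghE ij (s := (b, p, a')) Ha')).
Qed.

Lemma theta_coefZ i j b p c a : Rp p a ->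
  theta_coef i j b p (c *: a) = c *: theta_coef i j b p a.
Proof.
move=> Ha; rewrite /theta_coef; case: eqP => [_|/eqP ij].
  exact: theta_diagZ.
rewrite -[eh i j (b, p, c *: a)]/(emx pi i j b (c *: a)) (emxZ Rg piP).
exact: (sbil_Z2 beta_coc.1 c (ghH i) (ghE ij (s := (b, p, a)) Ha)).
Qed.

Lemma theta_coef0 i j b p : theta_coef i j b p 0 = 0.
Proof. by have := theta_coefZ i j b 0 (sg_0 Rg p); rewrite !scale0r. Qed.

(** The linear cochain whose coboundary is split off from beta. Entries are first decomposed into
    homogeneous components, because [theta_coefD] gives additivity within one parity. *)
Definition theta (X : M) : W := \sum_i \sum_j \sum_b \sum_p
  theta_coef i j b p (pi p (co b X i j)).

Lemma hproj0 p : pi p 0 = 0.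
Proof. by rewrite (hproj_id piP _ (sg_0 Rg p)) if_same. Qed.

Lemma theta_lin c X Y : theta (kscale c X + Y) = c *: theta X + theta Y.
Proof.
have H := hproj_homog piP.
rewrite /theta; do 4![rewrite scaler_sumr -big_split; apply: eq_bigr => ? _].
rewrite coD coZ (hproj_lin piP) theta_coefD //; last exact: sg_scale.
by rewrite theta_coefZ.
Qed.

Lemma theta0 : theta 0 = 0.
Proof.
by rewrite /theta; do 4![rewrite big1 // => ? _]; rewrite co0 hproj0 theta_coef0.
Qed.

Lemma thetaD X Y : theta (X + Y) = theta X + theta Y.
Proof. by have := theta_lin 1 X Y; rewrite kscale1 scale1r. Qed.

Lemma thetaZ c X : theta (kscale c X) = c *: theta X.
Proof. by have := theta_lin c X 0; rewrite theta0 !addr0. Qed.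

Lemma thetaN X : theta (- X) = - theta X.
Proof. by rewrite -kscaleN1 thetaZ scaleN1r. Qed.

Lemma theta_sg b X : theta (sg b X) = sg b (theta X).
Proof. by case: b => //; exact: thetaN. Qed.

Lemma theta_eh i j s : hvalid s -> theta (eh i j s) = theta_coef i j s.1.1 s.1.2 s.2.
Proof.
move=> hs; rewrite /theta (bigD1 i) //= (bigD1 j) //= (bigD1 s.1.1) //=.
rewrite (bigD1 s.1.2) //= co_emx !eqxx (hproj_id piP _ hs) eqxx.
rewrite !big1 ?addr0 // => [i' /negPf ii|j' /negPf jj|b /negPf bb|p /negPf pp].
- do 3![rewrite big1 // => ? _].
  by rewrite co_emx ii andbF hproj0 theta_coef0.
- do 2![rewrite big1 // => ? _].
  by rewrite co_emx jj !andbF hproj0 theta_coef0.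
- by rewrite big1 // => ? _; rewrite co_emx bb hproj0 theta_coef0.
- by rewrite (hproj_id piP _ hs) eq_sym pp theta_coef0.
Qed.

Lemma theta_coc : scocycle Rp (fun p X q Y => theta (sbr p q X Y)).
Proof.
split; first split.
- by move=> p q X X' Y _ _ _; rewrite sbrDl thetaD.
- by move=> p q X Y Y' _ _ _; rewrite sbrDr thetaD.
- move=> c p q X Y _ _; rewrite -thetaZ; congr theta.
  exact: sbr_kscalel.
- move=> c p q X Y _ _; rewrite -thetaZ; congr theta.
  by rewrite sbr_anti sbr_kscalel [in RHS]sbr_anti; case: (_ && _); rewrite /sg ?kscaleN.
- by move=> p q X Y _ _; rewrite sbr_anti thetaN theta_sg.
- move=> p q r X Y Z _ _ _; rewrite sbr_jacobi thetaD thetaN !theta_sg.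
  by [].
Qed.

(** The difference of the two sides is a cocycle, and [cocycle_rigid] reduces its vanishing to the
    torus acting on root vectors and to opposite root vectors. *)
Lemma beta_decomp p q X Y : gh p X -> gh q Y ->
  beta p X q Y = theta (sbr p q X Y) + trace_form Gam p X q Y.
Proof.
move=> hX hY.
have C := scocycleB (scocycleB beta_coc theta_coc)
  (trace_form_cocycle Rg n Gam_bilin Gam_cyc piP).
have n2 : (1 < n)%N by exact: ltnW.
have E : beta p X q Y - theta (sbr p q X Y) - trace_form Gam p X q Y = 0.
  apply: (cocycle_rigid Rg piP halfP n2 C _ _ hX hY) => {p q X Y hX hY}
    [i j s ij hs|i j s t ij hs ht].
    (* On e_ii(1) and e_ij(s) the trace form vanishes, and theta was chosen to match beta. *)
    have h1 := hvalid1; have Hij := negPf ij.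
    rewrite (torus_root Rg piP) // theta_eh // /theta_coef Hij.
    have -> : trace_form Gam false (eh i i (hone R)) (hpar s) (eh i j s) = 0.
      rewrite (trace_form_eh Rg pi Gam_bilin i i i j (s := hone R)) //.
      by rewrite [j == i]eq_sym Hij andbF.
    by rewrite subr0; case: s hs => [[b p] a] hs; exact: subrr.
  (* On opposite root vectors the claim amounts to [opp_pairingE]. *)
  have hst := hvalidM hs ht; have hts := hvalidM ht hs.
  rewrite (eh_br Rg piP) // !eqxx thetaD thetaN theta_sg !theta_eh //.
  have -> : trace_form Gam (hpar s) (eh i j s) (hpar t) (eh j i t) = trace_root Gam s t.
    by rewrite (trace_form_eh Rg pi Gam_bilin) // !eqxx.
  have tc l (u : hel R) : theta_coef l l u.1.1 u.1.2 u.2 = theta_diag l u.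
    by rewrite /theta_coef eqxx; case: u => [[]].
  rewrite (tc i (hmul s t)) (tc j (hmul t s)).
  rewrite -[beta _ _ _ _]/(F i j s t) opp_pairingE //.
  by case: (_ && _); rewrite /sg; zmod.
by apply: (eq_lincomb E); zmod.
Qed.

(** Summed over z, the decomposition of beta gives theta at [d2 z], which is zero, plus Gamma
    applied to [trace_map z], which is zero because Gamma factors through <R, R>. *)
Lemma cocycle_cycle_eq0 (z : FM) : Z2 Rp z -> BHC Rp (trace_map z) ->
  mext (unc2 beta) z = 0.
Proof.
move=> [vz dz] Bz.
transitivity (mext (unc2 (fun p X q Y => theta (sbr p q X Y))) z
              + mext (unc2 (trace_form Gam)) z).
  rewrite /mext -big_split !big_seq; apply: eq_bigr => -[[p X] [q Y]] /vz [hX hY].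
  rewrite -[RHS]scalerDr; congr (_ *: _); exact: beta_decomp.
have -> : mext (unc2 (fun p X q Y => theta (sbr p q X Y))) z = theta (d2 z).
  rewrite /mext /d2; elim: (enum_fset _) => [|t l IH]; first by rewrite !big_nil theta0.
  by rewrite !big_cons theta_lin IH.
rewrite dz theta0 add0r.
have := BHC_mext Gam_bilin Gam_cyc Bz; rewrite lin_trace_map => <-.
by apply: eq_mext_in => t _; do 2![apply: eq_bigr => ? _]; rewrite /= !mext_e2.
Qed.
End Injectivity.

(** Take for beta the universal cocycle, the class of a pair modulo boundaries. Its linear extension
    is the quotient map, so its vanishing at z says that z is a boundary. *)
Lemma trace_map_inj (half : k) (z : FM) : 2%:R * half = 1 -> (3 <= n)%N ->
  Z2 Rp z -> BHC Rp (trace_map z) -> B2 Rp z.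
Proof.
move=> halfP n3 Zz Bz; have [W [phi Hphi]] := kspan_quot (B2_gen Rp (n := n)).
apply/Hphi; rewrite (lin_mext phi).
have phiB v : B2_gen Rp v -> phi v = 0 by move=> Hv; apply/Hphi; exact: kspan_gen.
rewrite -[RHS](cocycle_cycle_eq0 halfP n3 (scocycle_lin phiB) Zz Bz).
by apply: eq_mext_in => -[[p X] [q Y]] _.
Qed.
End Iso.

Theorem theorem4p1 (k : comNzRingType) (R : algType k)
    (Rp : bool -> R -> Prop) (n : nat) :
  (exists i : k, 2%:R * i = 1) ->
  supergrading Rp ->
  (3 <= n)%N ->
  graded_quot_iso
    (Z2 Rp (n := n)) (B2 Rp (n := n)) (homog2 (T := 'M[R]_(n + n)))
    (ZHC Rp) (BHC Rp) (homog2 (T := R))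
    true.
Proof.
move=> [half halfP] Rg n3; have [pi piP] := homog_proj Rg.
have traceB (z z' : {malg k[((bool * 'M[R]_(n + n)) * (bool * 'M[R]_(n + n)))%type]}) :
  trace_map (z - z') = trace_map z - trace_map z' by exact: mextB.
exists (@trace_map k R n); split; first exact: (trace_map_cycle Rg piP).
split.
- move=> z z' _ _ Bzz; rewrite -traceB; exact: (trace_map_bound Rg piP).
- move=> c z z' _ _; rewrite [trace_map (_ + _)](mext_linear (unc2 (@trace_gen k R n))).
  rewrite subrr; exact: kspan0.
- by move=> z Zz Bz; exact: (trace_map_inj Rg piP halfP n3).
- move=> w Zw; exact: (trace_map_surj Rg piP (i0 := o0 n3) (i1 := o1 n3)).
- move=> s z _ hz; exists (trace_map z); split; first exact: trace_map_homog.
  rewrite subrr; exact: kspan0.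
Qed.
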